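(* Let $X$ be an $\alpha$-stable process with $\alpha\in[1,2)$, of infinite variation. Let $f:[0,\infty)\to[0,\infty)$ be continuous, increasing and concave with $f(0)=0=\lim_{c\downarrow0}\limsup_{t\downarrow0}f(ct)/f(t)$ and $f(t)\le 1=f(1)$ for $t\in(0,1]$, and let $F(t):=t/f(t)$ for $t>0$. Then the following statements hold. (a) If $t\mapsto t^{-1/\alpha}F(t)$ is bounded as $t\downarrow 0$, then $\limsup_{t\downarrow 0}|C'_t|f(t)=\infty$ a.s. (b) If $t^{-1/\alpha}F(t)\to\infty$ as $t\downarrow0$ and $X$ is not spectrally positive, then the limit $\limsup_{t\downarrow 0}|C'_t|f(t)$ is equal to $\infty$ (resp. $0$) a.s. if the integral $\int_0^1F(t)^{-\alpha}\,dt$ is infinite (resp. finite).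
   Context: An $\alpha$-stable process is a real-valued Lévy process $X=(X_t)_{t\ge0}$ with the scaling property that $X_t$ has the same law as $t^{1/\alpha}X_1$ for all $t>0$. It is spectrally positive if it has no negative jumps. Fix a deterministic $T>0$. $C=(C_t)_{t\in[0,T]}$ is the convex minorant of $X$ on $[0,T]$, i.e. the pointwise largest convex function with $C_t\le X_t$ for all $t\in[0,T]$. $C'=(C'_t)_{t\in(0,T)}$ is its right-derivative. ''Increasing'' means strictly increasing. *)

(* Defs.v *)
From HB Require Import structures.
From mathcomp Require Import all_boot all_order all_algebra.
From mathcomp Require Import all_classical all_reals all_analysis.

Set Implicit Arguments.
Unset Strict Implicit.
Unset Printing Implicit Defensive.

Import Order.TTheory GRing.Theory Num.Theory.
Import numFieldNormedType.Exports.

Local Open Scope classical_set_scope.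
Local Open Scope ring_scope.

(* Paths are total functions R -> R; only times t >= 0 are constrained. *)
Section Paths.
Context {R : realType}.
Implicit Types (x C f : R -> R) (t T : R).

Definition cadlag x : Prop :=
  (forall t : R, 0 <= t -> x s @[s --> t^'+] --> x t) /\
  (forall t : R, 0 < t -> cvg (x s @[s --> t^'-])).

Definition jump x t : R := x t - lim (x s @[s --> t^'-]).

Definition no_negative_jump x : Prop := forall t : R, 0 < t -> 0 <= jump x t.

Definition finite_variation x : Prop :=
  forall t : R, 0 < t -> bounded_variation 0 t x.

Definition is_convex_minorant T x C : Prop :=
  [/\ convex_function `[0, T]%classic C,
      forall t : R, 0 <= t <= T -> C t <= x t &
      forall g : R -> R, convex_function `[0, T]%classic g ->
        (forall t : R, 0 <= t <= T -> g t <= x t) ->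
        forall t : R, 0 <= t <= T -> g t <= C t].

Definition right_derivative x t : R :=
  lim (h^-1 * (x (t + h) - x t) @[h --> 0^'+]).

Definition concave_function (D : set R) f : Prop :=
  convex_function D (fun t => - f t).

Definition limsup0 (g : R -> R) : \bar R := limf_esup (EFin \o g) 0^'+.

End Paths.

Section Processes.
Context {R : realType} {d : measure_display} {Omega : measurableType d}.
Variable P : probability Omega R.

Definition same_law (Y Z : Omega -> R) : Prop :=
  forall B : set R, measurable B -> P (Y @^-1` B) = P (Z @^-1` B).

(* The product rule for subfamilies is the case B i = setT off the subfamily. *)
Definition mutually_independent n (Y : 'I_n -> Omega -> R) : Prop :=
  forall B : 'I_n -> set R, (forall i, measurable (B i)) ->
    P (\bigcap_(i in [set: 'I_n]) (Y i @^-1` B i)) =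
    (\prod_(i < n) P (Y i @^-1` B i))%E.

Variable X : R -> {RV P >-> R}.

Definition levy_process : Prop :=
  [/\ {ae P, forall w, X 0 w = 0},
      {ae P, forall w, cadlag (X^~ w)},
      (forall s t, 0 <= s -> s <= t ->
         same_law (fun w => X t w - X s w) (X (t - s))) &
      (forall n (t : nat -> R), 0 <= t 0 -> (forall i, t i <= t i.+1) ->
         mutually_independent (fun (i : 'I_n) w => X (t i.+1) w - X (t i) w))].

Definition stable_process (alpha : R) : Prop :=
  levy_process /\
  forall t : R, 0 < t -> same_law (X t) (fun w => t `^ alpha^-1 * X 1 w).

Definition spectrally_positive : Prop :=
  {ae P, forall w, no_negative_jump (X^~ w)}.

(* A Levy process either has a.s. paths of finite variation on every compact
   interval or is said to be of infinite variation. *)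
Definition infinite_variation : Prop :=
  ~ {ae P, forall w, finite_variation (X^~ w)}.

End Processes.

(* Main.v *)
Require Import Defs.
From HB Require Import structures.
From mathcomp Require Import all_boot all_order all_algebra.
From mathcomp Require Import all_classical all_reals all_analysis.
From mathcomp Require Import measurable_realfun.
From mathcomp Require Import ring lra zify.

Set Implicit Arguments.
Unset Strict Implicit.
Unset Printing Implicit Defensive.

Import Order.TTheory GRing.Theory Num.Theory.
Import numFieldNormedType.Exports.

Local Open Scope classical_set_scope.
Local Open Scope ring_scope.

(** Only the dyadic times t_n = 2^-n matter, with F increasing and F(t) / t
    decreasing. If X >= - A on [0, t] and X_(2t) <= - 4 A, then C' <= - A / t at
    t / 2; conversely, X >= - e F near 0 forces C_t >= - 2 e F(t), hence
    |C'_t| f(t) <= 2 e for small t.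

    Etemadi's inequality and scaling control the supremum of |X| on [0, t] by the
    tail of |X_1|, and, applied to n i.i.d. increments, show that this tail is
    O(y^-alpha). The sum of t_n F(t_n)^-alpha is comparable to the integral of
    F^-alpha, so Borel-Cantelli settles the convergent case.

    In the other cases take G(t) = t^(1/alpha), resp. F(t), and consider the drops
    of X by more than 5 K G(t_n) over [t_n, 2 t_n]. They are independent, and their
    probabilities are not summable, since P(X_1 < - y) is positive (X would
    otherwise be nondecreasing up to a drift), resp. at least of order y^-alpha
    when X has negative jumps. The first such drop does not depend on X on
    [0, t_n], where |X| <= K G(t_n) with probability tending to 1 as K grows. *)

(** The process is known only through its independent increments and the scaling of its marginals,
    so every tail estimate has to come from these two. Etemadi's inequality suits this: it asks
    neither symmetry nor a mean, and a mean may fail to exist when alpha = 1.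

    In the divergent cases the obstacle is that the calm events, |X| <= K G(t_n) on [0, t_n], refer
    to nested intervals and are dependent, so that the second Borel-Cantelli lemma does not apply to
    them jointly with the drops. Hence the split on the first drop: the index n runs towards time 0,
    drops of smaller index happen after t_n, and the first drop is an event of the increments after
    t_n. For fixed K this gives no more than the probability of calm; probability one comes from the
    union over large K, which costs nothing because a large K is also what makes the slope exceed
    every bound.

    The drop is 5 K G because X may stand at K G at time t_n and has to end below - 4 K G. *)

Section Paths.
Context {R : realType}.

Lemma at_rightP (Q : R -> Prop) a : (\forall s \near a^'+, Q s) ->
  exists2 e, 0 < e & forall s, a < s < a + e -> Q s.
Proof.
rewrite /at_right near_withinE => /nbhs_ballP[e /= e0 h]; exists e => //.
move=> s /andP[as_ sae]; apply: h => //.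
by rewrite /ball/= distrC ger0_norm ?subr_ge0 1?ltW// ltrBlDl.
Qed.

Lemma at_leftP (Q : R -> Prop) a : (\forall s \near a^'-, Q s) ->
  exists2 e, 0 < e & forall s, a - e < s < a -> Q s.
Proof.
rewrite /at_left near_withinE => /nbhs_ballP[e /= e0 h]; exists e => //.
move=> s /andP[as_ sae]; apply: h => //.
by rewrite /ball/= ger0_norm ?subr_ge0 1?ltW// ltrBlDr -ltrBlDl.
Qed.

Lemma right_near (x : R -> R) t e : cadlag x -> 0 <= t -> 0 < e ->
  exists2 dl, 0 < dl & forall s, t <= s < t + dl -> `|x s - x t| < e.
Proof.
move=> [rc _] t0 e0.
have /cvgrPdist_lt/(_ e e0)/at_rightP[dl dl0 h] := rc t t0.
exists dl => // s /andP[]; rewrite le_eqVlt => /predU1P[<-|ts] sd.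
  by rewrite subrr normr0.
by rewrite distrC; apply: h; rewrite ts.
Qed.

Lemma grid_above (s h : R) : 0 <= s -> 0 < h ->
  exists k : nat, k%:R * h <= s < k.+1%:R * h.
Proof.
move=> s0 h0; exists (Num.truncn (s / h)).
rewrite -ler_pdivlMr// -ltr_pdivrMr//.
have := truncn_itv (divr_ge0 s0 (ltW h0)); exact.
Qed.

Lemma small_inv (e : R) : 0 < e -> exists n : nat, n.+1%:R^-1 < e.
Proof.
move=> e0; exists (Num.truncn e^-1).
by rewrite invf_plt ?posrE ?ltr0Sn// truncnS_gt.
Qed.

Lemma small_dyadic (e : R) : 0 < e -> exists n : nat, (2 ^+ n)^-1 < e.
Proof.
move=> /small_inv[n h]; exists n; apply: le_lt_trans h.
rewrite lef_pV2 ?posrE ?ltr0Sn ?exprn_gt0// -natrX ler_nat.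
exact: ltn_expl.
Qed.

Definition dyad (n : nat) : R := (2 ^+ n)^-1.

Lemma dyad_gt0 n : 0 < dyad n. Proof. by rewrite invr_gt0 exprn_gt0. Qed.

Lemma dyadS n : 2 * dyad n.+1 = dyad n.
Proof. by rewrite /dyad exprS invfM mulrA divff ?mul1r// pnatr_eq0. Qed.

Lemma dyad_le m n : (m <= n)%N -> dyad n <= dyad m.
Proof.
by move=> mn; rewrite /dyad lef_pV2 ?posrE ?exprn_gt0// ler_weXn2l// ler1n.
Qed.

Lemma dyad_cell (s : R) N : 0 < s -> s <= dyad N ->
  exists n, [/\ (N <= n)%N, dyad n.+1 < s & s <= dyad n].
Proof.
move=> s0 sN; have [n0 hn0] := small_dyadic s0.
have ex : exists n, dyad n.+1 < s.
  by exists n0; apply: le_lt_trans hn0; exact: dyad_le.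
have := ex_minnP ex; case=> n hn hmin; exists n; split => //.
  by rewrite leqNgt; apply/negP => nN; move: hn; rewrite ltNge (le_trans sN)//; exact: dyad_le.
case: n hn hmin => [|n] hn hmin; first by apply: (le_trans sN); exact: dyad_le.
by rewrite leNgt; apply/negP => /hmin; rewrite ltnn.
Qed.

End Paths.

(** * Cadlag paths observed on grids *)

Section PathProperties.
Context {R : realType}.
Variables (x : R -> R).
Hypothesis cx : cadlag x.

(** Telescoping gives the bound between grid points, and right continuity carries it to s and u,
    each approximated by the next grid point on its right. *)
Lemma drift_lower_bound (y : R) : 0 <= y ->
  (forall n k : nat, - (y / n.+1%:R) <= x (k.+1%:R / n.+1%:R) - x (k%:R / n.+1%:R)) ->
  forall s u, 0 <= s -> s <= u -> - (y * (u - s)) <= x u - x s.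
Proof.
move=> y0 hx s u s0 su; rewrite leNgt; apply/negP => lt.
have hab n a b : (a <= b)%N ->
    - (y * (b%:R / n.+1%:R - a%:R / n.+1%:R)) <= x (b%:R / n.+1%:R) - x (a%:R / n.+1%:R).
  move=> /subnKC <-; elim: (b - a)%N => [|k IH]; first by rewrite addn0 !subrr mulr0 oppr0.
  have := hx n (a + k)%N; rewrite addnS => hk.
  have -> : y * ((a + k).+1%:R / n.+1%:R - a%:R / n.+1%:R) =
      y * ((a + k)%:R / n.+1%:R - a%:R / n.+1%:R) + y / n.+1%:R.
    by rewrite -[(a + k).+1%:R]natr1; ring.
  rewrite opprD; apply: le_trans (lerD IH hk) _.
  by rewrite addrC subrKA.
have us : s < u by rewrite lt_neqAle su andbT; apply/eqP => e; move: lt; rewrite e; lra.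
pose e := - (x u - x s) - y * (u - s).
have e0 : 0 < e by rewrite /e; lra.
have e4 : 0 < e / 4 by lra.
have [d1 d10 h1] := right_near cx s0 e4.
have [d2 d20 h2] := right_near cx (le_trans s0 su) e4.
(* Rounding s and u up lengthens the interval by at most one mesh, which costs at most y / (n + 1);
   [y + 1] keeps the divisor positive when y = 0. *)
have y1 : 0 < y + 1 by lra.
have /small_inv[n hn] : 0 < Num.min (Num.min d1 d2) (e / 4 / (y + 1)).
  by rewrite !lt_min d10 d20 divr_gt0.
rewrite !lt_min in hn; move/andP: hn => [/andP[hn1 hn2] hn3].
have n0 : 0 < n.+1%:R^-1 :> R by rewrite invr_gt0.
have [a /andP[a1 a2]] := grid_above s0 n0.
have [b /andP[b1 b2]] := grid_above (le_trans s0 su) n0.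
have ab : (a.+1 <= b.+1)%N.
  by rewrite ltnS -ltnS -(ltr_nat R) -(ltr_pM2r n0); apply: le_lt_trans b2; apply: le_trans a1 _.
have := hab n _ _ ab.
set v := n.+1%:R^-1 in a1 a2 b1 b2 hn1 hn2 hn3 n0 *.
rewrite -!natr1 in a2 b2 *; set A := (a%:R + 1) * v; set B := (b%:R + 1) * v.
have {}h1 := h1 A; have {}h2 := h2 B.
have : `|x A - x s| < e / 4 by apply: h1; rewrite /A; apply/andP; split; lra.
have : `|x B - x u| < e / 4 by apply: h2; rewrite /B; apply/andP; split; lra.
rewrite !ltr_norml => /andP[u1 u2] /andP[v1 v2] hAB.
have : y * (B - A) <= y * (u - s) + y * v.
  by rewrite -mulrDr ler_wpM2l// /A /B; lra.
have : y * v < e / 4.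
  move: hn3; rewrite ltr_pdivlMr//; lra.
rewrite /e in u1 u2 v1 v2 *; lra.
Qed.

(** x_s + y s is nondecreasing, so x is a difference of two monotone functions. The sign of y is
    free, hence two cases for the linear part. *)
Lemma drift_finite_variation (y : R) :
  (forall s u, 0 <= s -> s <= u -> - (y * (u - s)) <= x u - x s) ->
  finite_variation x.
Proof.
move=> h t t0.
have -> : x = (fun s => x s + y * s) \+ (\- (fun s => y * s)) by apply/funext => s/=; ring.
apply: bounded_variationD => //.
  apply: nondecreasing_bounded_variation => u v; rewrite !in_itv/= => /andP[u0 _] _ uv.
  by have := h u v u0 uv; lra.
apply: bounded_variationN; have [y0|y0] := leP 0 y.
  by apply: nondecreasing_bounded_variation => u v _ _ uv; exact: ler_wpM2l.
have -> : (fun s => y * s) = \- (fun s => - y * s) by apply/funext => s/=; ring.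
apply: bounded_variationN.
apply: nondecreasing_bounded_variation => u v _ _ uv; apply: ler_wpM2l => //; lra.
Qed.

(** The cell around t sees the jump: its left end is close to the left limit, its right end to x(t).
    Level and horizon share the one integer j, so that countably many events cover all negative
    jumps. *)
Lemma jump_detected t : 0 < t -> jump x t < 0 ->
  exists j n0 : nat, forall n, (n0 <= n)%N -> exists2 k, (k < n.+1)%N &
    x (k.+1%:R * (j.+1%:R / n.+1%:R)) - x (k%:R * (j.+1%:R / n.+1%:R)) < - j.+1%:R^-1.
Proof.
move=> t0 jt; have [l cl jE'] : exists2 l : R, x s @[s --> t^'-] --> l &
    jump x t = x t - l by have [_ /(_ t t0)] := cx; exists (lim (x s @[s --> t^'-])).
have [D jE D0] : exists2 D, x t = l - D & 0 < D by exists (- jump x t); lra.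
have D4 : 0 < D / 4 by lra.
move/cvgrPdist_lt/(_ _ D4)/at_leftP: cl => [d1 d10 h1].
have [d2 d20 h2] := right_near cx (ltW t0) D4.
have /small_inv[j hj] : 0 < Num.min (D / 2) t^-1.
  by rewrite lt_min invr_gt0 t0; apply/andP; split=> //; lra.
rewrite lt_min in hj; move/andP: hj => [hj1 hj2].
have jt' : t < j.+1%:R.
  by move: hj2; rewrite ltf_pV2 ?posrE ?ltr0Sn.
have /small_inv[n0 hn0] : 0 < Num.min d1 d2 / j.+1%:R.
  by rewrite divr_gt0// lt_min d10.
exists j, n0 => n n0n; set h := _ / n.+1%:R.
have h0 : 0 < h by rewrite divr_gt0.
have hh : h < Num.min d1 d2.
  rewrite /h mulrC -ltr_pdivlMr//; apply: le_lt_trans hn0.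
  by rewrite lef_pV2 ?posrE ?ltr0Sn// ler_nat.
rewrite lt_min in hh; move/andP: hh => [hd1 hd2].
(* This puts t in the half-open cell ]k h, (k + 1) h]: the left end has to be strictly before t,
   even when t is a grid point. *)
pose k := (`|Num.ceil (t / h)|%N).-1.
have c0 : 0 < Num.ceil (t / h) by rewrite ceil_gt0 divr_gt0.
have kE : k.+1%:R = (Num.ceil (t / h))%:~R :> R.
  rewrite /k prednK ?absz_gt0 ?gt_eqF// -[LHS]/((Posz _)%:~R).
  by rewrite gez0_abs// ltW.
have k1 : t <= k.+1%:R * h by rewrite -ler_pdivrMr// kE ceil_ge.
have k2 : k%:R * h < t.
  rewrite -ltr_pdivlMr//; have : k.+1%:R - 1 < t / h by rewrite kE -[1]/(1%:~R) -intrB ceilB1_lt.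
  by rewrite -natr1; lra.
exists k.
  rewrite -(ltr_nat R) -(ltr_pM2r h0); apply: (lt_trans k2).
  by rewrite /h mulrCA divff ?mulr1// pnatr_eq0.
have k3 : k.+1%:R * h = k%:R * h + h by rewrite -natr1; ring.
have := h1 (k%:R * h) _; have := h2 (k.+1%:R * h) _.
rewrite k3 in k1 *; set a := k%:R * h in k1 k2 *.
have e1 : t <= a + h < t + d2 by apply/andP; split; lra.
have e2 : t - d1 < a < t by apply/andP; split; lra.
move=> /(_ e1); rewrite ltr_norml => /andP[u1 u2] /(_ e2).
rewrite ltr_norml => /andP[v1 v2]; apply: (@lt_trans _ _ (- (D / 2))).
  rewrite jE in u1 u2; clear -u2 v2.
  lra.
by rewrite ltrN2.
Qed.

(** By right continuity an excess over b at s persists at a dyadic point just after s; s = t, after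
    which no point is left, is itself dyadic. *)
Lemma sup_dyadic (t b : R) : 0 < t ->
  (forall m k : nat, (k <= 2 ^ m)%N -> `|x (t * (k%:R / 2 ^+ m)) - x 0| <= b) ->
  forall s, 0 <= s <= t -> `|x s - x 0| <= b.
Proof.
move=> t0 h s /andP[s0]; rewrite le_eqVlt => /predU1P[->|st].
  by have := h 0%N 1%N isT; rewrite expr0 divff// mulr1.
rewrite leNgt; apply/negP => lt.
have gap : 0 < `|x s - x 0| - b by rewrite subr_gt0.
have [dl dl0 hd] := right_near cx s0 gap.
have [m hm] := small_dyadic (divr_gt0 dl0 t0).
have p0 : 0 < t * (2 ^+ m)^-1 by rewrite mulr_gt0// invr_gt0 exprn_gt0.
have [k /andP[k1 k2]] := grid_above s0 p0.
have km : (k < 2 ^ m)%N.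
  rewrite -(ltr_nat R) natrX -(ltr_pM2r p0); apply: (le_lt_trans k1).
  by rewrite mulrCA divff ?mulr1// expf_neq0.
have := h m _ km; set a := t * _.
have aE : a = k.+1%:R * (t * (2 ^+ m)^-1) by rewrite /a; ring.
have sa : s <= a < s + dl.
  rewrite aE ltW//=; apply: (@le_lt_trans _ _ (s + t * (2 ^+ m)^-1)).
    by rewrite -natr1 mulrDl mul1r lerD2r.
  by rewrite ltrD2l mulrC -ltr_pdivlMr.
have := hd _ sa; have := ler_distD (x a) (x s) (x 0); rewrite (distrC (x s) (x a)).
by move=> h1 h2 h3; lra.
Qed.

End PathProperties.

(** * Convexity without denominators *)

Section ConvexFunctions.
Context {R : realType}.
Implicit Types (D : set R) (g : R -> R).

(** The chord inequality cleared of denominators, so that degenerate triples are allowed and goals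
    stay polynomial. *)
Definition three_point D g := forall a b c : R, D a -> D c -> a <= b <= c ->
  g b * (c - a) <= g a * (c - b) + g c * (b - a).

Lemma convex_three_point D g : convex_function D g -> three_point D g.
Proof.
move=> hg a b c Da Dc /andP[ab bc].
have [ac|] := ltP a c; last first.
  move=> ca; have ea : b = a by apply/eqP; rewrite eq_le; lra.
  by have ec : c = a by [apply/eqP; rewrite eq_le; lra]; rewrite ea ec subrr !mulr0 addr0.
have ca0 : 0 < c - a by lra.
have t01 : (0 <= (c - b) / (c - a) <= 1).
  rewrite divr_ge0 ?subr_ge0// ?(ltW ac)// ler_pdivrMr//; lra.
pose t := Itv01 (andP t01).1 (andP t01).2.
set u : R := (c - b) / (c - a) in t01 t.
have : g (u * a + (1 - u) * c) <= u * g a + (1 - u) * g c.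
  exact: (hg t a c (mem_set Da) (mem_set Dc)).
have -> : u * a + (1 - u) * c = b by rewrite /u; field; rewrite gt_eqF.
rewrite -(ler_pM2r ca0) => /le_trans; apply.
rewrite le_eqVlt; apply/orP; left; apply/eqP.
by rewrite /u; field; rewrite gt_eqF.
Qed.

Lemma three_point_convex D g : three_point D g -> convex_function D g.
Proof.
move=> hg.
suff H (u a c : R) : 0 <= u -> u <= 1 -> D a -> D c ->
    g (u * a + (1 - u) * c) <= u * g a + (1 - u) * g c.
  move=> t a c /set_mem Da /set_mem Dc.
  exact: (H t%:inum a c (ge0 t) (le1 t) Da Dc).
move=> u0 u1 Da Dc; have [ac|ca|->] := ltgtP a c.
- have := hg a (u * a + (1 - u) * c) c Da Dc.
  have ca0 : 0 < c - a by lra.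
  set b := u * a + (1 - u) * c => h; rewrite -(ler_pM2r ca0).
  have p1 : 0 <= (1 - u) * (c - a) by apply: mulr_ge0; lra.
  have p2 : 0 <= u * (c - a) by apply: mulr_ge0; lra.
  have /h : a <= b <= c by rewrite /b; apply/andP; split; lra.
  by move=> /le_trans; apply; rewrite le_eqVlt /b; apply/orP; left; apply/eqP; ring.
- have := hg c (u * a + (1 - u) * c) a Dc Da.
  have ca0 : 0 < a - c by lra.
  set b := u * a + (1 - u) * c => h; rewrite -(ler_pM2r ca0).
  have p1 : 0 <= (1 - u) * (a - c) by apply: mulr_ge0; lra.
  have p2 : 0 <= u * (a - c) by apply: mulr_ge0; lra.
  have /h : c <= b <= a by rewrite /b; apply/andP; split; lra.
  by move=> /le_trans; apply; rewrite le_eqVlt /b; apply/orP; left; apply/eqP; ring.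
- by rewrite -!mulrDl subrKC !mul1r.
Qed.

Lemma convex_max_affine D g (m p : R) : convex_function D g ->
  convex_function D (fun s => Num.max (g s) (m * s + p)).
Proof.
move=> /convex_three_point hg; apply: three_point_convex => a b c Da Dc.
move=> /[dup] abc /andP[ab bc]; have := hg a b c Da Dc abc.
set A := Num.max (g a) _; set Cc := Num.max (g c) _ => h.
have A1 : g a <= A by rewrite le_max lexx.
have A2 : m * a + p <= A by rewrite le_max lexx orbT.
have C1 : g c <= Cc by rewrite le_max lexx.
have C2 : m * c + p <= Cc by rewrite le_max lexx orbT.
have cb : 0 <= c - b by lra.
have ba : 0 <= b - a by lra.
rewrite maxr_pMl; last by lra.
rewrite ge_max; apply/andP; split.
  apply: (le_trans h).
  by apply: lerD; apply: ler_wpM2r.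
have -> : (m * b + p) * (c - a) = (m * a + p) * (c - b) + (m * c + p) * (b - a) by ring.
by apply: lerD; apply: ler_wpM2r.
Qed.

End ConvexFunctions.

(** * Slopes and bounds of the convex minorant *)

Section ConvexMinorant.
Context {R : realType}.
Variables (T : R) (x C : R -> R).
Hypothesis T0 : 0 < T.
Hypothesis hC : is_convex_minorant T x C.

Local Notation rd := (right_derivative C).

Lemma minorant_le s : 0 <= s <= T -> C s <= x s.
Proof. by have [_ + _] := hC; exact. Qed.

Lemma minorant_three_point a b c : 0 <= a -> a <= b -> b <= c -> c <= T ->
  C b * (c - a) <= C a * (c - b) + C c * (b - a).
Proof.
have [hc _ _] := hC; move=> a0 ab bc cT.
apply: (convex_three_point hc); rewrite /= ?in_itv/=.
- by rewrite a0 (le_trans ab (le_trans bc cT)).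
- by rewrite cT (le_trans a0 (le_trans ab bc)).
- by rewrite ab.
Qed.

(* [max(C, affine)] is again a convex function below [x]. *)
Lemma affine_le_minorant (m p : R) :
  (forall s, 0 <= s <= T -> m * s + p <= x s \/ m * s + p <= C s) ->
  forall s, 0 <= s <= T -> m * s + p <= C s.
Proof.
have [hc hx hmax] := hC => h s sT.
have := hmax _ (convex_max_affine m p hc) _ s sT.
rewrite ge_max => H; apply: (andP (H _)).2 => u uT.
rewrite ge_max hx//=; have [//|h1] := h u uT.
by apply: (le_trans h1); exact: hx.
Qed.

Let slope t h := h^-1 * (C (t + h) - C t).

Lemma slope_left s t h : 0 <= s -> s < t -> 0 < h -> t + h <= T ->
  (C t - C s) / (t - s) <= slope t h.
Proof.
move=> s0 st h0 thT; have := @minorant_three_point s t (t + h) s0 (ltW st) _ thT.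
rewrite lerDl => /(_ (ltW h0)) H.
rewrite /slope ler_pdivrMr ?subr_gt0// -mulrA ler_pdivlMl//.
lra.
Qed.

Lemma slope_homo t h k : 0 <= t -> 0 < h -> h <= k -> t + k <= T ->
  slope t h <= slope t k.
Proof.
move=> t0 h0 hk tkT; have := @minorant_three_point t (t + h) (t + k) t0 _ _ tkT.
rewrite lerDl lerD2l => /(_ (ltW h0) hk) H.
have k0 := lt_le_trans h0 hk.
rewrite /slope ler_pdivrMl// mulrCA ler_pdivlMl//; lra.
Qed.

(** Slopes are nondecreasing in h and bounded below by the chord slope from 0. [right_derivative] is
    a [lim], which carries information only once this convergence is known. *)
Lemma rd_cvg t : 0 < t < T -> slope t h @[h --> 0^'+] --> rd t.
Proof.
move=> /andP[t0 tT].
suff : cvg (slope t h @[h --> 0^'+]) by [].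
have Tt : 0 < T - t by rewrite subr_gt0.
apply: nondecreasing_at_right_is_cvgr.
  near=> e => h k; rewrite !in_itv/= => /andP[h0 he] /andP[k0 ke] hk.
  apply: slope_homo => //; first exact: ltW.
  have : e < T - t by near: e; exact: nbhs_right_lt.
  lra.
near=> e; exists ((C t - C 0) / (t - 0)) => _ [h /= + <-].
rewrite in_itv/= => /andP[h0 he]; apply: slope_left => //.
have : e < T - t by near: e; exact: nbhs_right_lt.
lra.
Unshelve. all: by end_near. Qed.

Lemma rd_le t h : 0 < t -> 0 < h -> t + h <= T -> rd t <= (C (t + h) - C t) / h.
Proof.
move=> t0 h0 thT; have tT : 0 < t < T by rewrite t0; lra.
have hcv := rd_cvg tT; rewrite mulrC.
rewrite -(cvg_lim (@Rhausdorff R) hcv).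
apply: limr_le; first by apply/cvg_ex; exists (rd t).
near=> k; apply: slope_homo => //; first exact: ltW.
by near: k; exact: nbhs_right_le.
Unshelve. all: by end_near. Qed.

Lemma rd_ge s t : 0 <= s -> s < t -> t < T -> (C t - C s) / (t - s) <= rd t.
Proof.
move=> s0 st tT; have t0 := le_lt_trans s0 st.
have hcv := rd_cvg (introT andP (conj t0 tT)).
rewrite -(cvg_lim (@Rhausdorff R) hcv).
apply: limr_ge; first by apply/cvg_ex; exists (rd t).
near=> k; apply: slope_left => //.
have : k < T - t by near: k; apply: nbhs_right_lt; rewrite subr_gt0.
lra.
Unshelve. all: by end_near. Qed.

(** Convexity bounds C above through its endpoint values, and C(s) + C(T - s) >= 2 C(T / 2); the
    upper bound at one of the two points is thus a lower bound at the other. *)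
Lemma minorant_bounded : exists2 B : R, 0 < B & forall s, 0 <= s <= T -> - B <= C s.
Proof.
pose M := `|C 0| + `|C T|.
exists (2 * `|C (T / 2)| + M + 1).
  by rewrite /M; have := normr_ge0 (C (T / 2)); have := normr_ge0 (C 0);
     have := normr_ge0 (C T); lra.
have n1 := ler_norm (C 0); have n2 := ler_norm (C T).
have n3 := normr_ge0 (C 0); have n4 := normr_ge0 (C T).
have n5 : - `|C (T / 2)| <= C (T / 2) by rewrite lerNl ler_normr lexx orbT.
have up u : 0 <= u <= T -> C u <= M.
  move=> /andP[u0 uT]; rewrite -(ler_pM2r T0).
  have := @minorant_three_point 0 u T (lexx _) u0 uT (lexx _).
  rewrite !subr0 => /le_trans; apply.
  have : C 0 * (T - u) <= `|C 0| * T.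
    apply: (@le_trans _ _ (`|C 0| * (T - u))); first by apply: ler_wpM2r => //; lra.
    by apply: ler_wpM2l => //; lra.
  have : C T * u <= `|C T| * T.
    apply: (@le_trans _ _ (`|C T| * u)); first by apply: ler_wpM2r.
    by apply: ler_wpM2l.
  by rewrite /M; lra.
have key s : 0 <= s <= T / 2 -> 2 * C (T / 2) - M <= C s /\ 2 * C (T / 2) - M <= C (T - s).
  move=> /andP[s0 sT].
  have u1 := up s ltac:(lra); have u2 := up (T - s) ltac:(lra).
  have := @minorant_three_point s (T / 2) (T - s) s0 sT ltac:(lra) ltac:(lra).
  (* At the midpoint the three-point inequality degenerates to 0 <= 0. *)
  have [->|sT'] := eqVneq s (T / 2).
    have -> : T - T / 2 = T / 2 by lra.
    have := up (T / 2) ltac:(lra); lra.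
  have sT2 : 0 < T / 2 - s by rewrite subr_gt0 lt_neqAle sT'.
  have -> : T - s - s = (T / 2 - s) * 2 by lra.
  have -> : T - s - T / 2 = T / 2 - s by lra.
  rewrite -mulrDl mulrA mulrAC ler_pM2r// => H; split; lra.
move=> s /andP[s0 sT]; have [h|h] := leP s (T / 2).
  have [] := key s ltac:(lra); lra.
have [_] := key (T - s) ltac:(lra); have -> : T - (T - s) = s by ring.
lra.
Qed.

(* If C' >= - A / t at t, then C_t <= - 3 A, and the segment from (0, - A) to
   (t, C_t) lies below C, so that C_(t/2) is at least the mean of - A and C_t. *)
Lemma steep_slope (A t : R) : 0 < A -> 0 < t -> 2 * t <= T ->
  (forall s, 0 <= s <= t -> - A <= x s) -> x (2 * t) <= - (4 * A) ->
  rd (t / 2) <= - (A / t).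
Proof.
move=> A0 t0 tT xA x2.
have t2 : 0 < t / 2 by lra.
have rd2 : rd (t / 2) <= (C t - C (t / 2)) / (t / 2).
  have H := @rd_le (t / 2) (t / 2) t2 t2.
  have E : t / 2 + t / 2 = t by lra.
  by rewrite E in H; apply: H; lra.
(* If C' is already below - A / t at t, it is so at t / 2: the slope of the chord over [t / 2, t]
   lies between the two derivatives. *)
have [lt|ge] := ltP (rd t) (- (A / t)).
  apply: (le_trans rd2); apply: (le_trans _ (ltW lt)).
  have H := @rd_ge (t / 2) t (ltW t2).
  have E : t - t / 2 = t / 2 by lra.
  by rewrite E in H; apply: H; lra.
have C2 : C (2 * t) <= - (4 * A).
  by apply: le_trans x2; apply: minorant_le; apply/andP; split; lra.
have tt2 : t + t = 2 * t by ring.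
have Ct : C t <= - (3 * A).
  have := @rd_le t t t0 t0; rewrite tt2 => /(_ tT) /(le_trans ge).
  rewrite ler_pdivlMr// mulNr divfK ?gt_eqF//; lra.
pose m := (C t + A) / t.
have mle : m <= - (A / t).
  by rewrite /m ler_pdivrMr// mulNr divfK ?gt_eqF//; lra.
have m0 : m <= 0 by apply: (le_trans mle); rewrite oppr_le0 ltW// divr_gt0.
have mt : m * t = C t + A by rewrite /m divfK// gt_eqF.
have := @affine_le_minorant m (- A) _ (t / 2).
have H : forall s, 0 <= s <= T -> m * s + - A <= x s \/ m * s + - A <= C s.
  move=> s /andP[s0 sT]; have [st|ts] := leP s t.
    left; apply: (@le_trans _ _ (- A)); last by apply: xA; rewrite s0.
    by have := mulr_le0_ge0 m0 s0; lra.
  (* Beyond t, C lies above its tangent at t, whose slope is at least [m], and the segment meets C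
     at t. *)
  right; have := @rd_le t (s - t) t0; rewrite subr_gt0 => /(_ ts).
  rewrite addrC subrK => /(_ sT) /(le_trans ge) /(le_trans mle).
  rewrite ler_pdivlMr ?subr_gt0//; lra.
move=> /(_ H) /(_ ltac:(lra)) Ct2.
apply: (le_trans rd2); rewrite ler_pdivrMr//.
have -> : - (A / t) * (t / 2) = - A / 2 by field; rewrite gt_eqF.
lra.
Qed.

End ConvexMinorant.

(** * Real-valued probabilities and monotone limits of events *)

Section RealProbability.
Context {R : realType} {d : measure_display} {Omega : measurableType d}.
Variable P : probability Omega R.
Implicit Types (A B : set Omega).

Definition Pr A : R := fine (P A).

Lemma PrE A : measurable A -> P A = (Pr A)%:E.
Proof. by move=> mA; rewrite /Pr fineK// fin_num_measure. Qed.

Lemma Pr_ge0 A : 0 <= Pr A.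
Proof. by rewrite /Pr fine_ge0. Qed.

Lemma Pr_le1 A : measurable A -> Pr A <= 1.
Proof. by move=> mA; rewrite -lee_fin -PrE// probability_le1. Qed.

Lemma PrT : Pr setT = 1.
Proof. by rewrite /Pr probability_setT. Qed.

Lemma Pr0 : Pr set0 = 0.
Proof. by rewrite /Pr measure0. Qed.

Lemma le_Pr A B : measurable A -> measurable B -> A `<=` B -> Pr A <= Pr B.
Proof.
by move=> mA mB AB; rewrite -lee_fin -!PrE//; apply: le_measure; rewrite ?inE.
Qed.

Lemma PrC A : measurable A -> Pr (~` A) = 1 - Pr A.
Proof.
move=> mA; apply: EFin_inj; rewrite -PrE; last exact: measurableC.
by rewrite probability_setC// PrE.
Qed.

Lemma PrU_le A B : measurable A -> measurable B -> Pr (A `|` B) <= Pr A + Pr B.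
Proof.
move=> mA mB; rewrite -lee_fin EFinD -!PrE//; last exact: measurableU.
exact: measureU2.
Qed.

Lemma PrU A B : measurable A -> measurable B -> A `&` B = set0 ->
  Pr (A `|` B) = Pr A + Pr B.
Proof.
move=> mA mB AB; apply: EFin_inj; rewrite EFinD -!PrE//; last exact: measurableU.
by rewrite measureU.
Qed.

Lemma Pr_neg A : measurable A -> P.-negligible A <-> Pr A = 0.
Proof.
move=> mA; apply: (iff_trans (negligibleP _ mA)); rewrite /Pr; split=> [->//|h].
by have := PrE mA; rewrite [in X in X -> _]/Pr h; exact.
Qed.

Definition upto (F : nat -> set Omega) (n : nat) : set Omega :=
  [set w | exists2 k, (k < n)%N & F k w].

Lemma upto0 F : upto F 0 = set0.
Proof. by apply/seteqP; split => w //= -[]. Qed.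

Lemma uptoS F n : upto F n.+1 = upto F n `|` F n.
Proof.
apply/seteqP; split => w /=.
  move=> [k]; rewrite ltnS leq_eqVlt => /orP[/eqP->|kn] Fk; first by right.
  by left; exists k.
by case=> [[k kn Fk]|Fn]; [exists k => //; rewrite ltnS ltnW|exists n].
Qed.

Lemma measurable_upto F n : (forall k, measurable (F k)) -> measurable (upto F n).
Proof.
move=> mF; elim: n => [|n IH]; first by rewrite upto0.
by rewrite uptoS; apply: measurableU.
Qed.

Lemma Pr_upto_le F n : (forall k, measurable (F k)) ->
  Pr (upto F n) <= \sum_(k < n) Pr (F k).
Proof.
move=> mF; elim: n => [|n IH]; first by rewrite upto0 Pr0 big_ord0.
rewrite uptoS big_ord_recr/=; apply: (le_trans (PrU_le _ _)) => //.
  exact: measurable_upto.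
by rewrite lerD2r.
Qed.

Lemma Pr_upto F n : (forall k, measurable (F k)) ->
  (forall i j w, (i < j)%N -> F i w -> ~ F j w) ->
  Pr (upto F n) = \sum_(k < n) Pr (F k).
Proof.
move=> mF dF; elim: n => [|n IH]; first by rewrite upto0 Pr0 big_ord0.
rewrite uptoS big_ord_recr/= PrU ?IH//; first exact: measurable_upto.
by apply/seteqP; split => w //= -[[k kn Fk]]; exact: dF kn Fk.
Qed.

Lemma cvg_Pr_bigcup F : (forall k, measurable (F k)) ->
  {homo F : n m / (n <= m)%N >-> n `<=` m} ->
  Pr (F n) @[n --> \oo] --> Pr (\bigcup_n F n).
Proof.
move=> mF hF; apply: fine_cvg; rewrite -PrE; last exact: bigcupT_measurable.
apply: nondecreasing_cvg_mu => //; first exact: bigcupT_measurable.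
by move=> n m nm; apply/subsetPset; exact: hF.
Qed.

Lemma cvg_Pr_bigcap F : (forall k, measurable (F k)) ->
  {homo F : n m / (n <= m)%N >-> m `<=` n} ->
  Pr (F n) @[n --> \oo] --> Pr (\bigcap_n F n).
Proof.
move=> mF hF; apply: fine_cvg; rewrite -PrE; last exact: bigcapT_measurable.
apply: nonincreasing_cvg_mu => //; last 2 first.
- exact: bigcapT_measurable.
- by move=> n m nm; apply/subsetPset; exact: hF.
- by apply: (le_lt_trans (probability_le1 P (mF 0%N))); rewrite ltry.
Qed.

Lemma Pr_bigcup_le F c : (forall k, measurable (F k)) ->
  {homo F : n m / (n <= m)%N >-> n `<=` m} ->
  (forall n, Pr (F n) <= c) -> Pr (\bigcup_n F n) <= c.
Proof.
move=> mF hF cF; have h := cvg_Pr_bigcup mF hF.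
by rewrite -(cvg_lim _ h)//; apply: limr_le; [apply/cvg_ex; eexists; exact: h|exact: nearW].
Qed.

Lemma Pr_bigcap_ge F c : (forall k, measurable (F k)) ->
  {homo F : n m / (n <= m)%N >-> m `<=` n} ->
  (forall n, c <= Pr (F n)) -> c <= Pr (\bigcap_n F n).
Proof.
move=> mF hF cF; have h := cvg_Pr_bigcap mF hF.
by rewrite -(cvg_lim _ h)//; apply: limr_ge; [apply/cvg_ex; eexists; exact: h|exact: nearW].
Qed.

End RealProbability.

(** * Independence from the past of a sequence *)

Section Independence.
Context {R : realType} {d : measure_display} {Omega : measurableType d}.
Variable P : probability Omega R.
Implicit Types (A : set Omega) (Y : nat -> Omega -> R) (B : nat -> set R).

Definition cyl Y k n B :
    set Omega := [set w | forall i, (k <= i < n)%N -> B i (Y i w)].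

(** The pi-system of cylinders over the first k variables; [<<s past Y k >>] is the sigma-algebra
    generated by Y_0, ..., Y_(k-1). *)
Definition past Y (k : nat) : set (set Omega) :=
  [set A | exists2 B : nat -> set R, (forall i, measurable (B i)) &
     A = cyl Y 0 k B].

Lemma measurable_cyl Y k n B : (forall i, measurable_fun setT (Y i)) ->
  (forall i, measurable (B i)) -> measurable (cyl Y k n B).
Proof.
move=> mY mB.
have -> : cyl Y k n B = \bigcap_(i in [set i | (k <= i < n)%N]) (Y i @^-1` B i).
  by apply/seteqP; split.
apply: bigcap_measurableType => i _; rewrite -[X in measurable X]setTI.
exact: mY.
Qed.

Lemma past_measurable Y k A : (forall i, measurable_fun setT (Y i)) ->
  <<s past Y k >> A -> measurable A.
Proof.
move=> mY; apply: smallest_sub => [|_ [B mB ->]]; first exact: sigma_algebra_measurable.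
exact: measurable_cyl.
Qed.

Lemma past_preimage Y k i (B : set R) : (i < k)%N -> measurable B ->
  <<s past Y k >> (Y i @^-1` B).
Proof.
move=> ik mB; apply: sub_sigma_algebra.
exists (fun j => if j == i then B else setT).
  by move=> j; case: ifP.
apply/seteqP; split => w /=.
  by move=> Bw j _; case: ifP => // /eqP ->.
by move=> /(_ i); rewrite eqxx; exact.
Qed.

Section ProductRule.
Variable Y : nat -> Omega -> R.
Hypothesis mY : forall i, measurable_fun setT (Y i).
Hypothesis indY : forall n B, (forall i, measurable (B i)) ->
  Pr P (cyl Y 0 n B) = \prod_(0 <= i < n) Pr P (Y i @^-1` B i).

Lemma Pr_cyl k n B : (forall i, measurable (B i)) ->
  Pr P (cyl Y k n B) = \prod_(k <= i < n) Pr P (Y i @^-1` B i).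
Proof.
move=> mB; have [kn|nk] := leqP k n; last first.
  rewrite big_geq ?(ltnW nk)// -(PrT P); congr (Pr P _).
  by apply/seteqP; split => // w _ i /andP[ki]; rewrite ltnNge (leq_trans (ltnW nk)).
pose B' i := if (i < k)%N then setT else B i.
have -> : cyl Y k n B = cyl Y 0 n B'.
  apply/seteqP; split => w /= h i /andP[i0 ni].
    by rewrite /B'; case: ltnP => // ki; apply: h; rewrite ki.
  by have := h i ni; rewrite /B' ltnNge i0.
rewrite indY => [|i]; last by rewrite /B'; case: ifP.
rewrite (big_cat_nat (leq0n k) kn)//= big_nat big1 ?mul1r => [|i ik].
  by apply: eq_big_nat => i /andP[ki _]; rewrite /B' ltnNge ki.
by rewrite /B' (andP ik).2 preimage_setT PrT.
Qed.

(* Dynkin's pi-lambda theorem, started from the product rule on cylinders. *)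
Lemma indep_past k n A B : (forall i, measurable (B i)) ->
  <<s past Y k >> A -> Pr P (A `&` cyl Y k n B) = Pr P A * Pr P (cyl Y k n B).
Proof.
move=> mB; set Z := cyl Y k n B.
have mZ : measurable Z by exact: measurable_cyl.
have mp S : <<s past Y k >> S -> measurable S by exact: past_measurable.
apply: (@dynkin_induction _ (g_sigma_algebraType (past Y k)) (past Y k)
  (fun A => Pr P (A `&` Z) = Pr P A * Pr P Z)) => //.
- move=> _ _ [B1 mB1 ->] [B2 mB2 ->]; exists (fun i => B1 i `&` B2 i).
    by move=> i; exact: measurableI.
  apply/seteqP; split => w /=; first by move=> [h1 h2] i ik; split; [exact: h1|exact: h2].
  by move=> h; split => i /h [].
- by rewrite setTI PrT mul1r.
- move=> _ [B1 mB1 ->].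
  have [kn|nk] := leqP k n; last first.
    suff -> : Z = setT by rewrite setIT PrT mulr1.
    by apply/seteqP; split => // w _ i /andP[ki]; rewrite ltnNge (leq_trans (ltnW nk)).
  pose B' i := if (i < k)%N then B1 i else B i.
  have mB' i : measurable (B' i) by rewrite /B'; case: ifP.
  have -> : cyl Y 0 k B1 `&` Z = cyl Y 0 n B'.
    apply/seteqP; split => w /=.
      move=> [h1 h2] i /= ni; rewrite /B'; case: ltnP => ki; first exact: h1.
      by apply: h2; rewrite ki.
    move=> h; split => i.
      by move=> /andP[_ ki]; have := h i; rewrite /B' ki (leq_trans ki kn); exact.
    by move=> /andP[ki ni]; have := h i ni; rewrite /B' ltnNge ki.
  rewrite !Pr_cyl// (big_cat_nat (leq0n k) kn)//=; congr (_ * _).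
    by apply: eq_big_nat => i /andP[_ ik]; rewrite /B' ik.
  by apply: eq_big_nat => i /andP[ki _]; rewrite /B' ltnNge ki.
- move=> S /mp mS hS; have mC := measurableC mS.
  have e : Pr P Z = Pr P (S `&` Z) + Pr P (~` S `&` Z).
    rewrite -PrU; [|exact: measurableI..|]; first by rewrite -setIUl setUv setTI.
    by rewrite setIACA setICr set0I.
  by rewrite PrC// mulrBl mul1r -hS e addrC addKr.
- move=> F mF tF hF.
  have mF' i : @measurable d Omega (F i) by apply: mp; exact: mF.
  apply: EFin_inj; rewrite EFinM -!PrE//; last 2 first.
    exact: bigcupT_measurable.
    by apply: measurableI => //; exact: bigcupT_measurable.
  rewrite setI_bigcupl !measure_bigcup//; last 2 first.
    by move=> i _; exact: measurableI.
    exact: trivIset_setIr.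
  rewrite muleC PrE// -nneseriesZl//; apply: eq_eseriesr => i _.
  transitivity (Pr P (F i `&` Z))%:E; first by apply: PrE; exact: measurableI.
  by rewrite hF mulrC EFinM; congr (_ * _)%E; symmetry; exact: PrE.
Qed.

End ProductRule.

End Independence.

(** * First occurrence in a sequence of events *)

Section FirstOccurrence.
Context {d : measure_display} {Omega : measurableType d}.
Implicit Types F : nat -> set Omega.

Definition first F k : set Omega := F k `&` ~` upto F k.

Lemma upto_first F n : upto (first F) n = upto F n.
Proof.
elim: n => [|n IH]; first by rewrite !upto0.
rewrite !uptoS IH; apply/seteqP; split => w /=; first by case=> [|[]]; [left|right].
case=> [|Fn]; first by left.
by have [U|U] := pselect (upto F n w); [left|right].
Qed.

Lemma first_disjoint F i j w : (i < j)%N -> first F i w -> ~ first F j w.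
Proof. by move=> ij [Fi _] [_]; apply; exists i. Qed.

(** Measurability is asked up to n only, because the lemma is applied in the sigma-algebra of the
    past, where later events need not be measurable. *)
Lemma measurable_first F n : (forall k, (k <= n)%N -> measurable (F k)) ->
  measurable (first F n).
Proof.
move=> mF; apply: measurableI; first exact: mF.
apply: measurableC.
have -> : upto F n = upto (fun k => if (k <= n)%N then F k else set0) n.
  by apply/seteqP; split => w [k kn]; [|rewrite (ltnW kn)] => Fk; exists k => //; rewrite (ltnW kn).
by apply: measurable_upto => k; case: ifP => // /mF.
Qed.

End FirstOccurrence.

(** * Increments and tails of a stable process *)

Section StableProcess.
Context {R : realType} {d : measure_display} {Omega : measurableType d}.
Variables (P : probability Omega R) (alpha : R) (X : R -> {RV P >-> R}).
Hypothesis alpha0 : 0 < alpha.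
Hypothesis hX : stable_process X alpha.

Definition inc (s t : R) (w : Omega) : R := X t w - X s w.
Definition abs_tail (y : R) : R := Pr P [set w | y < `|X 1 w|].
Definition neg_tail (y : R) : R := Pr P [set w | X 1 w < - y].

Lemma measurable_inc s t : measurable_fun setT (inc s t).
Proof. exact: measurable_funB. Qed.

Lemma measurable_gt_norm (y : R) : measurable [set z : R | y < `|z|].
Proof.
have := @normr_measurable R setT measurableT _ (measurable_itv `]y, +oo[).
by rewrite setTI; congr measurable; apply/seteqP; split => z /=; rewrite in_itv/= andbT.
Qed.

Lemma measurable_lt (y : R) : measurable [set z : R | z < y].
Proof.
exact: (measurable_itv `]-oo, y[%R).
Qed.

Lemma measurable_preimage (f : Omega -> R) (B : set R) :
  measurable_fun setT f -> measurable B -> measurable (f @^-1` B).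
Proof. by move=> mf mB; rewrite -[X in measurable X]setTI; exact: mf. Qed.

Lemma inc_law (s t : R) B : 0 <= s -> s < t -> measurable B ->
  Pr P (inc s t @^-1` B) =
  Pr P ((X 1 : Omega -> R) @^-1` ((fun z => (t - s) `^ alpha^-1 * z) @^-1` B)).
Proof.
move=> s0 st mB; have [[_ _ hst _] hsc] := hX.
rewrite /Pr (hst s t s0 (ltW st) B mB); congr fine.
by rewrite (hsc (t - s)) ?subr_gt0.
Qed.

Lemma abs_tail_inc (s t y : R) : 0 <= s -> s < t ->
  Pr P [set w | y < `|inc s t w|] = abs_tail (y / (t - s) `^ alpha^-1).
Proof.
move=> s0 st; have c0 : 0 < (t - s) `^ alpha^-1 by rewrite powR_gt0// subr_gt0.
rewrite (_ : [set w | _] = inc s t @^-1` [set z | y < `|z|])// inc_law//.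
  congr (Pr P _); apply/seteqP; split => w /=.
    by rewrite normrM gtr0_norm// ltr_pdivrMr// mulrC.
  by rewrite normrM gtr0_norm// ltr_pdivrMr// mulrC.
exact: measurable_gt_norm.
Qed.

Lemma neg_tail_inc (s t y : R) : 0 <= s -> s < t ->
  Pr P [set w | inc s t w < - y] = neg_tail (y / (t - s) `^ alpha^-1).
Proof.
move=> s0 st; have c0 : 0 < (t - s) `^ alpha^-1 by rewrite powR_gt0// subr_gt0.
rewrite (_ : [set w | _] = inc s t @^-1` [set z | z < - y])// inc_law//.
  congr (Pr P _); apply/seteqP; split => w /=.
    by rewrite -mulNr ltr_pdivlMr// mulrC.
  by rewrite -mulNr ltr_pdivlMr// mulrC.
exact: measurable_lt.
Qed.

Lemma measurable_abs_inc_gt s t y : measurable [set w | y < `|inc s t w|].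
Proof.
exact: (measurable_preimage (measurable_inc s t) (measurable_gt_norm y)).
Qed.

Lemma measurable_inc_lt s t y : measurable [set w | inc s t w < y].
Proof. exact: (measurable_preimage (measurable_inc s t) (measurable_lt y)). Qed.

Lemma measurable_abs_gt y : measurable [set w | y < `|X 1 w|].
Proof.
by apply: (@measurable_preimage (X 1) [set z | y < `|z|]) => //; exact: measurable_gt_norm.
Qed.

Lemma measurable_lt_level y : measurable [set w | X 1 w < y].
Proof.
by apply: (@measurable_preimage (X 1) [set z | z < y]) => //; exact: measurable_lt.
Qed.

Lemma abs_tail_nonincr (x y : R) : x <= y -> abs_tail y <= abs_tail x.
Proof.
move=> xy; apply: le_Pr; [exact: measurable_abs_gt..|].
by move=> w /=; exact: le_lt_trans.
Qed.

Lemma neg_tail_nonincr (x y : R) : x <= y -> neg_tail y <= neg_tail x.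
Proof.
move=> xy; apply: le_Pr; [exact: measurable_lt_level..|].
by move=> w /= h; apply: (lt_le_trans h); rewrite lerN2.
Qed.

Lemma abs_tail_ge0 y : 0 <= abs_tail y. Proof. exact: Pr_ge0. Qed.
Lemma abs_tail_le1 y : abs_tail y <= 1. Proof. by apply: Pr_le1; exact: measurable_abs_gt. Qed.
Lemma neg_tail_ge0 y : 0 <= neg_tail y. Proof. exact: Pr_ge0. Qed.

(** A shorter interval has a smaller tail by scaling. The case s = t is included because grids may
    repeat a point; the event is then empty. *)
Lemma abs_tail_inc_le (s t u y : R) : 0 <= s -> s <= t -> t - s <= u -> 0 < u -> 0 <= y ->
  Pr P [set w | y < `|inc s t w|] <= abs_tail (y / u `^ alpha^-1).
Proof.
move=> s0; rewrite le_eqVlt => /predU1P[<-|st] tsu u0 y0.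
  rewrite (_ : [set w | _] = set0) ?Pr0 ?abs_tail_ge0//.
  by apply/seteqP; split => w //=; rewrite /inc subrr normr0 ltNge y0.
rewrite abs_tail_inc//; apply: abs_tail_nonincr; rewrite ler_wpM2l//.
rewrite lef_pV2 ?posrE ?powR_gt0 ?subr_gt0//.
by apply: ge0_ler_powR; rewrite ?nnegrE ?invr_ge0 ?subr_ge0//; exact: ltW.
Qed.

Lemma abs_tail_cvg0 (e : R) : 0 < e -> exists2 l : R, 0 < l & abs_tail l <= e.
Proof.
move=> e0; pose F n := [set w | n%:R < `|X 1 w|].
have h : Pr P (F n) @[n --> \oo] --> Pr P (\bigcap_n F n).
  apply: cvg_Pr_bigcap; first by move=> k; exact: measurable_abs_gt.
  by move=> n m nm w /=; apply: le_lt_trans; rewrite ler_nat.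
have F0 : \bigcap_n F n = set0.
  apply/seteqP; split => w //= Fw.
  have := Fw (Num.truncn `|X 1 w|).+1 I; rewrite /F/= ltNge.
  by rewrite ltW// truncnS_gt.
rewrite F0 Pr0 in h.
move/cvgrPdist_le : h => /(_ e e0)[n _ /(_ n.+1 (leqnSn _))]/=.
rewrite sub0r normrN ger0_norm ?Pr_ge0// => h.
by exists n.+1%:R.
Qed.

Section Grid.
Variable t : nat -> R.
Hypothesis t0 : 0 <= t 0.
Hypothesis tS : forall i, t i <= t i.+1.

Definition gridinc (i : nat) : Omega -> R := inc (t i) (t i.+1).

Lemma grid_homo i j : (i <= j)%N -> t i <= t j.
Proof.
move=> /subnKC <-; elim: (j - i)%N => [|k IH]; first by rewrite addn0.
by rewrite addnS; exact: le_trans IH (tS _).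
Qed.

Lemma grid_ge0 i : 0 <= t i.
Proof. by rewrite (le_trans t0)//; exact: (@grid_homo 0 i). Qed.

Lemma gridinc_indep n (B : nat -> set R) : (forall i, measurable (B i)) ->
  Pr P (cyl gridinc 0 n B) = \prod_(0 <= i < n) Pr P (gridinc i @^-1` B i).
Proof.
move=> mB; have [[_ _ _ hi] _] := hX.
have := hi n t t0 tS (fun i => B i) (fun i => mB i).
rewrite (_ : \bigcap_(i in [set: 'I_n]) _ = cyl gridinc 0 n B); last first.
  apply/seteqP; split => w h; last by move=> i _; apply: h => /=.
  by move=> i /andP[_ ni]; exact: (h (Ordinal ni) I).
have mg i : measurable (gridinc i @^-1` B i).
  by apply: measurable_preimage => //; exact: measurable_inc.
move=> h; apply: EFin_inj; rewrite -PrE; last first.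
  by apply: measurable_cyl => // i; exact: measurable_inc.
by rewrite h big_mkord -prodEFin; apply: eq_bigr => i _; rewrite -PrE.
Qed.

(** The increment is the sum of the first j grid increments, each measurable for the sigma-algebra
    of the past. *)
Lemma past_inc k j B : (j <= k)%N -> measurable B ->
  <<s past gridinc k >> (inc (t 0) (t j) @^-1` B).
Proof.
move=> jk mB.
pose S := g_sigma_algebraType (past gridinc k).
suff mS : measurable_fun setT (inc (t 0) (t j) : S -> R).
  by have := mS measurableT _ mB; rewrite setTI.
elim: j jk => [|j IH] jk.
  rewrite (_ : inc _ _ = cst 0); first exact: measurable_cst.
  by apply/funext => w; rewrite /inc subrr.
rewrite (_ : inc _ _ = inc (t 0) (t j) \+ gridinc j); last first.
  by apply/funext => w; rewrite /gridinc /inc/=; ring.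
apply: measurable_funD; first exact: IH (ltnW jk).
by move=> _ C mC; rewrite setTI; exact: past_preimage.
Qed.

End Grid.

(* Etemadi: split at the first k with |S_k| > 3x; then either |S_n| > x, or the
   increment from t_k to t_n, independent of the splitting event, exceeds 2x. *)
Lemma maximal_inequality (t : nat -> R) n (u x : R) : 0 <= t 0 ->
  (forall i, t i <= t i.+1) -> 0 < u -> t n - t 0 <= u -> 0 <= x ->
  Pr P (upto (fun k => [set w | 3 * x < `|inc (t 0) (t k) w|]) n.+1) <=
  2 * abs_tail (x / u `^ alpha^-1).
Proof.
move=> t0 tS u0 tnu x0; set E := fun k => _; set qq := abs_tail _.
have mE k : measurable (E k) by exact: measurable_abs_inc_gt.
have mF k : measurable (first E k) by exact: measurable_first.
set Z := [set w | x < `|inc (t 0) (t n) w|].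
have mZ : measurable Z by exact: measurable_abs_inc_gt.
pose G k := [set w | 2 * x < `|inc (t k) (t n) w|].
have mG k : measurable (G k) by exact: measurable_abs_inc_gt.
have tm i j : (i <= j)%N -> t i <= t j by exact: grid_homo.
have tp i : 0 <= t i by exact: grid_ge0.
have PZ : Pr P Z <= qq by apply: abs_tail_inc_le => //; exact: tm.
have PG k : (k <= n)%N -> Pr P (G k) <= qq.
  move=> kn; apply: (le_trans (abs_tail_inc_le _ _ _ u0 _)) => //.
  - exact: tm.
  - by apply: le_trans tnu; rewrite lerD2l lerN2 tm.
  - by rewrite mulr_ge0.
  - by apply: abs_tail_nonincr; rewrite ler_wpM2r ?invr_ge0 ?powR_ge0//; lra.
have FG k : (k <= n)%N -> Pr P (first E k `&` G k) = Pr P (first E k) * Pr P (G k).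
  (* Freezing the grid at t_n after index k makes the increment from t_k to t_n a single grid
     increment, the one of index k. *)
  move=> kn; pose t' i := if (i <= k)%N then t i else t n.
  have t'S i : t' i <= t' i.+1.
    rewrite /t'; case: (ltnP i k) => ik; first by rewrite (ltnW ik).
    by case: ifP => // h; apply: tm; exact: leq_trans h kn.
  pose B (i : nat) := [set z : R | 2 * x < `|z|].
  have mB i : measurable (B i) by exact: measurable_gt_norm.
  have GE : G k = cyl (gridinc t') k k.+1 B.
    apply/seteqP; split => w /=.
      move=> h i; rewrite ltnS -eqn_leq => /eqP <-.
      by rewrite /B/= /gridinc /t' leqnn ltnn.
    by move=> /(_ k); rewrite leqnn ltnSn /B /= /gridinc /t' leqnn ltnn; exact.
  rewrite GE; apply: indep_past => //.
  - by move=> i; exact: measurable_inc.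
  - by move=> m D mD; apply: gridinc_indep.
  - apply: (@measurable_first _ (g_sigma_algebraType (past (gridinc t') k))).
    move=> j jk; have := @past_inc t' k j _ jk (measurable_gt_norm (3 * x)).
    by rewrite /t' jk leq0n; exact.
have sub : upto E n.+1 `<=` Z `|` upto (fun k => first E k `&` G k) n.+1.
  rewrite -upto_first => w [k kn Fk].
  have [Zw|nZ] := pselect (Z w); [by left|right; exists k => //; split => //].
  move: Fk nZ => [Ek _] /negP; rewrite -leNgt => nZ.
  rewrite /E /= in Ek; rewrite /G /=.
  have -> : inc (t k) (t n) w = inc (t 0) (t n) w - inc (t 0) (t k) w.
    by rewrite /inc; ring.
  by have := lerB_dist (inc (t 0) (t k) w) (inc (t 0) (t n) w); rewrite distrC => /(lt_le_trans _); apply; lra.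
have mFG k : measurable (first E k `&` G k) by exact: measurableI.
apply: (le_trans (le_Pr P _ _ sub)).
- exact: measurable_upto.
- by apply: measurableU => //; exact: measurable_upto.
apply: (le_trans (PrU_le _ _ _)) => //; first exact: measurable_upto.
rewrite mulr_natl mulr2n lerD//.
apply: (le_trans (Pr_upto_le _ _ _)) => //.
apply: (@le_trans _ _ (\sum_(k < n.+1) Pr P (first E k) * qq)).
  apply: ler_sum => k _; rewrite FG ?leq_ord//; apply: ler_wpM2l; first exact: Pr_ge0.
  by rewrite PG// leq_ord.
(* The splitting events are disjoint, so their probabilities add up to at most 1. *)
rewrite -mulr_suml -Pr_upto//; last by move=> i j w; exact: first_disjoint.
rewrite ler_piMl ?abs_tail_ge0//; apply: Pr_le1; exact: measurable_upto.
Qed.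

(** A polynomial substitute for 1 - p <= exp(- p): a large sum of probabilities of independent
    events makes it unlikely that none occurs. The induction step is (1 - p)(1 + S + p) <= 1 + S. *)
Lemma prod_compl_le (R' : realFieldType) (p : nat -> R') n :
  (forall i, 0 <= p i <= 1) ->
  (\prod_(0 <= i < n) (1 - p i)) * (1 + \sum_(0 <= i < n) p i) <= 1.
Proof.
move=> p01; elim: n => [|n IH]; first by rewrite !big_geq// addr0 mulr1.
rewrite !big_nat_recr//=; apply: le_trans IH.
set Q := \prod_(_ <= _ < _) _; set S := \sum_(_ <= _ < _) _.
have Q0 : 0 <= Q by apply: prodr_ge0 => i _; have := p01 i; lra.
have S0 : 0 <= S by apply: sumr_ge0 => i _; have := p01 i; lra.
rewrite -mulrA ler_wpM2l//; have /andP[p0 p1] := p01 n.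
by have := mulr_ge0 p0 S0; have := mulr_ge0 p0 p0; nra.
Qed.

Lemma measurable_le_norm (y : R) : measurable [set z : R | `|z| <= y].
Proof.
have := measurableC (measurable_gt_norm y); congr measurable.
by apply/seteqP; split => z /=; rewrite leNgt => /negP.
Qed.

(* One of n i.i.d. increments exceeds 6x only if some partial sum exceeds 3x. *)
Lemma abs_tail_nat_le (l : R) n : 0 < l -> abs_tail l <= 4^-1 ->
  abs_tail (6 * l * n.+1%:R `^ alpha^-1) <= n.+1%:R^-1.
Proof.
move=> l0 ql; set m := n.+1; set c := _ `^ _.
have c0 : 0 < c by rewrite powR_gt0// ltr0Sn.
pose t (i : nat) : R := i%:R.
have t0 : 0 <= t 0%N by [].
have tS i : t i <= t i.+1 by rewrite ler_nat.
have x0 : 0 <= l * c by rewrite mulr_ge0// ltW.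
have := @maximal_inequality t m m%:R (l * c) t0 tS (ltr0Sn _ _).
rewrite /t subr0 lexx => /(_ isT x0); rewrite -/c mulfK ?gt_eqF//.
set E := fun k => _; move=> hE.
pose B (i : nat) := [set z : R | `|z| <= 6 * (l * c)].
have mB i : measurable (B i) by exact: measurable_le_norm.
set p := abs_tail _.
have PB i : Pr P (gridinc t i @^-1` B i) = 1 - p.
  have := @abs_tail_inc (t i) (t i.+1) (6 * (l * c)) _ _.
  have -> : t i.+1 - t i = 1 by rewrite /t -natr1 addrAC subrr add0r.
  rewrite powR1 divr1 mulrA -/p => <-; last 2 first.
  - exact: ler0n.
  - by rewrite ltr_nat.
  rewrite -PrC; last exact: measurable_abs_inc_gt.
  by congr (Pr P _); apply/seteqP; split => w /=; rewrite /gridinc /B/= mulrA leNgt => /negP.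
have sub : ~` cyl (gridinc t) 0 m B `<=` upto E m.+1.
  move=> w /= nB; apply: contrapT => nE; apply: nB => i /andP[_ im].
  have hk k : (k <= m)%N -> `|inc (t 0%N) (t k) w| <= 3 * (l * c).
    by move=> km; rewrite leNgt; apply/negP => h; apply: nE; exists k.
  have -> : gridinc t i w = inc (t 0%N) (t i.+1) w - inc (t 0%N) (t i) w.
    by rewrite /gridinc /inc; ring.
  rewrite /B /=; have := hk _ im; have := hk _ (ltnW im).
  by have := ler_normB (inc (t 0%N) (t i.+1) w) (inc (t 0%N) (t i) w); lra.
have mY i : measurable_fun setT (gridinc t i) by exact: measurable_inc.
have mC : measurable (cyl (gridinc t) 0 m B) by exact: measurable_cyl.
have := le_trans (le_Pr P (measurableC mC) _ sub) hE.
rewrite PrC// gridinc_indep// (eq_bigr (fun=> 1 - p))// => h.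
have p01 (i : nat) : 0 <= p <= 1 by rewrite abs_tail_ge0 abs_tail_le1.
have := prod_compl_le m p01; rewrite sumr_const_nat subn0 => h2.
have {}h : 1 - \prod_(0 <= i < m) (1 - p) <= 2 * abs_tail l.
  by apply: h; apply: measurable_upto => k; exact: measurable_abs_inc_gt.
have m0 : 0 < m%:R :> R by rewrite ltr0Sn.
rewrite -[_^-1]mul1r ler_pdivlMr// mulr_natr.
set Q := \prod_(_ <= _ < _) _ in h h2; set pm := p *+ m in h2 *.
have pm0 : 0 <= pm by rewrite mulrn_wge0// abs_tail_ge0.
clear p01.
(* The bound 1/4 on [abs_tail l] makes Q at least 1/2; then Q (1 + m p) <= 1 gives m p <= 1. *)
have : (1 / 2) * (1 + pm) <= Q * (1 + pm) by apply: ler_wpM2r; lra.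
lra.
Qed.

(** With y = 6 l z and v = z^alpha, the bound for the integer part n + 1 of v is used, and the
    trivial bound 1 when v < 1. The factor 2 pays for the rounding, as v < n + 2 <= 2 (n + 1). *)
Lemma abs_tail_le : exists2 K : R, 0 < K & forall y, 0 < y -> abs_tail y <= K * y `^ (- alpha).
Proof.
have [l l0 ql] := @abs_tail_cvg0 4^-1 ltac:(lra).
have l60 : 0 < 6 * l by lra.
exists (2 * (6 * l) `^ alpha); first by rewrite mulr_gt0// powR_gt0.
move=> y y0; pose z := y / (6 * l).
have z0 : 0 < z by rewrite divr_gt0.
have zE : y = 6 * l * z by rewrite /z mulrC divfK// gt_eqF.
set v := z `^ alpha; have v0 : 0 < v by rewrite powR_gt0.
have -> : 2 * (6 * l) `^ alpha * y `^ (- alpha) = 2 / v.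
  rewrite {1}zE powRN (powRM _ (ltW l60) (ltW z0)) -/v.
  by rewrite invfM mulrA mulfK// gt_eqF// powR_gt0.
have [v1|v1] := ltP v 1.
  apply: (le_trans (abs_tail_le1 _)); rewrite ler_pdivlMr// mul1r; lra.
have := truncn_itv (ltW v0); case: (Num.truncn v) => [|n] /andP[n1 n2].
  by move: n2; lra.
apply: (@le_trans _ _ (abs_tail (6 * l * n.+1%:R `^ alpha^-1))).
  apply: abs_tail_nonincr; rewrite zE ler_pM2l//.
  have -> : z = v `^ alpha^-1.
    by rewrite /v -powRrM mulfV ?powRr1 ?ltW// gt_eqF.
  by apply: ge0_ler_powR; rewrite ?nnegrE ?invr_ge0 ?ler0n// ltW.
apply: (le_trans (abs_tail_nat_le n l0 ql)).
have n0 : 0 < n.+1%:R :> R by rewrite ltr0Sn.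
rewrite ler_pdivlMr// ler_pdivrMl//.
have : 1 <= n.+1%:R :> R by rewrite ler1n.
by move: n2; rewrite -[n.+2%:R]natr1; lra.
Qed.

(* If P(X_1 < - y) = 0, no increment over a grid of mesh 1/n is below - y / n, so
   that X_t + y t is nondecreasing. *)
Lemma neg_tail_gt0 (y : R) : infinite_variation X -> 0 < neg_tail y.
Proof.
move=> hIV; wlog y0 : y / 0 < y => [h|].
  apply: lt_le_trans (h (`|y| + 1) _) _; first by have := normr_ge0 y; lra.
  by apply: neg_tail_nonincr; have := ler_norm y; lra.
rewrite lt_neqAle neg_tail_ge0 andbT eq_sym; apply/eqP => ry.
pose Bad n k := [set w | inc (k%:R / n.+1%:R) (k.+1%:R / n.+1%:R) w < - (y / n.+1%:R)].
have mBad n k : measurable (Bad n k) by exact: measurable_inc_lt.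
have step n k : (k%:R / n.+1%:R : R) <= k.+1%:R / n.+1%:R.
  by rewrite ler_wpM2r ?invr_ge0// ler_nat.
have Bad0 n k : Pr P (Bad n k) = 0.
  have PBad j : Pr P (Bad n j) = neg_tail (y / n.+1%:R / (n.+1%:R^-1) `^ alpha^-1).
    rewrite /Bad neg_tail_inc//.
    - by congr (neg_tail (_ / _ `^ _)); rewrite -[j.+1%:R]natr1 mulrDl mul1r addrAC subrr add0r.
    - by rewrite ltr_pM2r ?ltr_nat// invr_gt0.
  rewrite PBad; set rho := neg_tail _.
  pose t (i : nat) : R := i%:R / n.+1%:R.
  have t0 : 0 <= t 0%N by rewrite /t mul0r.
  pose B (i : nat) := [set z : R | z < - (y / n.+1%:R)].
  have mB i : measurable (B i) by exact: measurable_lt.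
  (* If all n + 1 increments over the cells of [0, 1] are below - y / (n + 1), then X_1 - X_0 < - y;
     by independence rho^(n+1) <= P(X_1 < - y) = 0. *)
  have sub : cyl (gridinc t) 0 n.+1 B `<=` [set w | inc 0 1 w < - y].
    move=> w hw; have : forall j, (j <= n)%N -> inc 0 (t j.+1) w < - (y / n.+1%:R) *+ j.+1.
      elim=> [|j IH] jn.
        by have := hw 0%N; rewrite /B/gridinc/= {1}/t mul0r; exact.
      have := IH (ltnW jn); have := hw j.+1 jn; rewrite /B/gridinc/= mulrSr.
      by rewrite /inc; set u := _ *+ _; lra.
    move=> /(_ n (leqnn _)); rewrite /t divff// mulNrn.
    by rewrite -[_ / _ *+ _]mulr_natr divfK.
  have := le_Pr P _ (measurable_inc_lt 0 1 (- y)) sub.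
  rewrite neg_tail_inc// subr0 powR1 divr1 ry gridinc_indep//; last by move=> i; exact: step.
  rewrite (eq_bigr (fun=> rho)) => [|i _]; last exact: PBad.
  rewrite prodr_const_nat subn0 => h; apply/eqP.
  have /h : measurable (cyl (gridinc t) 0 n.+1 B).
    by apply: measurable_cyl => // i; exact: measurable_inc.
  move=> {}h; have : rho ^+ n.+1 == 0 by rewrite eq_le h exprn_ge0// neg_tail_ge0.
  by rewrite expf_eq0.
apply: hIV; have [[_ hc _ _] _] := hX.
have hbad : {ae P, forall w, forall n k, ~ Bad n k w}.
  have : P.-negligible (\bigcup_n \bigcup_k Bad n k).
    apply: negligible_bigcup => n; apply: negligible_bigcup => k.
    by apply/Pr_neg.
  apply: negligibleS => w /= /existsNP[n /existsNP[k /contrapT h]].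
  by exists n => //; exists k.
apply: filterS2 hc hbad => w cw bw.
apply: (@drift_finite_variation _ (X^~ w) y).
apply: drift_lower_bound => //; first exact: ltW.
by move=> n k; rewrite leNgt; apply/negP => h; apply: (bw n k).
Qed.

(* With positive probability all fine grids of mesh h detect a jump below a fixed
   level, so the union bound gives P(X_h < - dl) at least of order h. *)
Lemma neg_tail_ge : ~ spectrally_positive X ->
  exists2 c : R, 0 < c &
    exists y0 : R, forall y, y0 <= y -> c * y `^ (- alpha) <= neg_tail y.
Proof.
move=> nsp; pose h (j n : nat) : R := j.+1%:R / n.+1%:R.
pose D j n := upto (fun k => [set w | inc (k%:R * h j n) (k.+1%:R * h j n) w < - j.+1%:R^-1]) n.+1.
have mD j n : measurable (D j n).
  by apply: measurable_upto => k; exact: measurable_inc_lt.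
pose J j n0 := \bigcap_n D j (n0 + n)%N.
have mJ j n0 : measurable (J j n0) by exact: bigcapT_measurable.
have h0 j n : 0 < h j n by rewrite divr_gt0.
(* Otherwise the countably many [J j n0] are all null, and almost no path has a negative jump. *)
have [j [n0 J0]] : exists j n0, 0 < Pr P (J j n0).
  apply: contrapT => nJ; apply: nsp; have [[_ hc _ _] _] := hX.
  have hbad : {ae P, forall w, forall j n0, ~ J j n0 w}.
    have : P.-negligible (\bigcup_j \bigcup_n0 J j n0).
      apply: negligible_bigcup => j; apply: negligible_bigcup => n0.
      apply/Pr_neg => //; apply/eqP; rewrite eq_le Pr_ge0 andbT leNgt.
      by apply/negP => H; apply: nJ; exists j, n0.
    apply: negligibleS => w /= /existsNP[j /existsNP[n0 /contrapT H]].
    by exists j => //; exists n0.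
  apply: filterS2 hc hbad => w cw bw t t0; rewrite leNgt; apply/negP => jt.
  have [j [n0 H]] := jump_detected cw t0 jt.
  apply: (bw j n0) => n _; have [k kn Hk] := H _ (leq_addr n n0).
  by exists k.
set q0 := Pr P _ in J0; set dl : R := j.+1%:R^-1.
have dl0 : 0 < dl by rewrite invr_gt0.
pose N : R := j.+1%:R; have N0 : 0 < N by [].
have key n : (n0 <= n)%N -> q0 / n.+1%:R <= neg_tail (dl / (h j n) `^ alpha^-1).
  move=> n0n; rewrite ler_pdivrMr// mulr_natr.
  have : q0 <= Pr P (D j n).
    by apply: le_Pr => // w /(_ (n - n0)%N I); rewrite subnKC.
  move=> /le_trans; apply; apply: (le_trans (Pr_upto_le _ _ _)).
    by move=> k; exact: measurable_inc_lt.
  rewrite (eq_bigr (fun=> neg_tail (dl / (h j n) `^ alpha^-1))) ?sumr_const ?card_ord//.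
  move=> k _; rewrite neg_tail_inc.
  - by rewrite -mulrBl -[k.+1%:R]natr1 addrAC subrr add0r mul1r.
  - by rewrite mulr_ge0// ltW.
  - by rewrite ltr_pM2r// ltr_nat.
(* Let v = (y / dl)^alpha and take for n the integer part of N v. Then v h <= 1, so that dl /
   h^(1/alpha) >= y, while n + 1 <= 2 N v turns q0 / (n + 1) into q0 / (2 N v). The threshold on y
   ensures n >= n0. *)
exists (q0 / (2 * N) * dl `^ alpha).
  by rewrite mulr_gt0 ?powR_gt0// divr_gt0// mulr_gt0.
exists (dl * n0.+1%:R `^ alpha^-1) => y hy.
pose z := y / dl; have zE : y = dl * z by rewrite /z mulrC divfK// gt_eqF.
have hz : n0.+1%:R `^ alpha^-1 <= z by move: hy; rewrite zE ler_pM2l.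
have z0 : 0 < z by apply: lt_le_trans hz; rewrite powR_gt0.
set v := z `^ alpha; have v0 : 0 < v by rewrite powR_gt0.
have vz : z = v `^ alpha^-1.
  by rewrite /v -powRrM mulfV ?powRr1 ?ltW// gt_eqF.
have hv : n0.+1%:R <= v.
  rewrite /v; have -> : n0.+1%:R = (n0.+1%:R `^ alpha^-1) `^ alpha :> R.
    by rewrite -powRrM mulVf ?powRr1// gt_eqF.
  by apply: ge0_ler_powR; rewrite ?nnegrE ?powR_ge0// ltW.
have N1 : 1 <= N by rewrite ler1n.
have := truncn_itv (ltW (mulr_gt0 N0 v0)); set n := Num.truncn _ => /andP[n1 n2].
have n0n : (n0 <= n)%N.
  rewrite -ltnS -(ltr_nat R); apply: lt_le_trans (_ : n0.+1%:R <= _); first by rewrite ltr_nat.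
  apply: (le_trans hv); apply: (le_trans _ (ltW n2)).
  by rewrite ler_peMl// ltW.
have v1 : 1 <= v by apply: le_trans hv; rewrite ler1n.
apply: (@le_trans _ _ (q0 / n.+1%:R)).
  have -> : q0 / (2 * N) * dl `^ alpha * y `^ (- alpha) = q0 / (2 * N * v).
    rewrite zE powRN (powRM _ (ltW dl0) (ltW z0)) -/v.
    by rewrite !invfM mulrA mulfK ?mulrA// gt_eqF// powR_gt0.
  rewrite ler_pM2l// lef_pV2 ?posrE ?mulr_gt0//.
  have : 1 <= N * v by rewrite -[1]mulr1 ler_pM.
  by rewrite -natr1; lra.
apply: (le_trans (key n n0n)); apply: neg_tail_nonincr.
rewrite ler_pdivlMr ?powR_gt0// zE -mulrA -[leRHS]mulr1 ler_pM2l//.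
rewrite vz -(powRM _ (ltW v0) (ltW (h0 j n))).
have vh : v * h j n <= 1.
  by rewrite /h mulrA ler_pdivrMr// mul1r mulrC ltW.
have vh0 : 0 <= v * h j n by rewrite ltW// mulr_gt0.
have := @ge0_ler_powR R alpha^-1 _ _ _ vh0 ler01 vh.
by rewrite powR1; apply; rewrite invr_ge0 ltW.
Qed.

(** * Suprema over an interval, through dyadic points *)

Section Exceedance.
Variables t x : R.
Hypotheses (t0 : 0 < t) (x0 : 0 <= x).

Definition exc_dyadic (m : nat) : set Omega :=
  upto (fun k => [set w | 3 * x < `|inc 0 (t * (k%:R / 2 ^+ m)) w|]) (2 ^ m).+1.

(** Only countably many times enter, which makes this measurable; on a cadlag path it contains every
    excess of |X - X_0| over 3 x on [0, t]. The 3 is that of Etemadi's inequality. *)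
Definition exc : set Omega := \bigcup_m exc_dyadic m.

Lemma measurable_exc_dyadic m : measurable (exc_dyadic m).
Proof. by apply: measurable_upto => k; exact: measurable_abs_inc_gt. Qed.

Lemma measurable_exc : measurable exc.
Proof. by apply: bigcupT_measurable => m; exact: measurable_exc_dyadic. Qed.

Lemma exc_dyadic_homo : {homo exc_dyadic : n m / (n <= m)%N >-> n `<=` m}.
Proof.
move=> n m nm; rewrite -(subnKC nm); move: (m - n)%N => l w [k kn /= h].
exists (k * 2 ^ l)%N; first by rewrite ltnS expnD leq_mul2r -ltnS kn orbT.
suff -> : t * ((k * 2 ^ l)%:R / 2 ^+ (n + l)) = t * (k%:R / 2 ^+ n) by exact: h.
by rewrite natrM natrX exprD invfM mulrACA divff ?mulr1// expf_neq0.
Qed.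

(** Etemadi's bound is the same at every dyadic level, and the levels increase with m. *)
Lemma Pr_exc : Pr P exc <= 2 * abs_tail (x / t `^ alpha^-1).
Proof.
apply: Pr_bigcup_le; [exact: measurable_exc_dyadic|exact: exc_dyadic_homo|] => m.
pose g (i : nat) := t * (i%:R / 2 ^+ m).
have g0 : g 0%N = 0 by rewrite /g mul0r mulr0.
have := @maximal_inequality g (2 ^ m)%N t x _ _ t0 _ x0.
rewrite g0; apply => //.
- by move=> i; rewrite ler_pM2l// ler_wpM2r ?invr_ge0 ?exprn_ge0// ler_nat.
- by rewrite /g natrX divff ?expf_neq0// mulr1 subr0.
Qed.

Lemma exc_path w : cadlag (X^~ w) -> ~ exc w ->
  forall s, 0 <= s <= t -> `|X s w - X 0 w| <= 3 * x.
Proof.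
move=> cw nw; apply: (sup_dyadic cw t0) => m k km.
by rewrite leNgt; apply/negP => h; apply: nw; exists m => //; exists k.
Qed.

End Exceedance.

(** * A large drop preceded by a calm stretch *)

Section Hits.
Variables (N : nat) (y x : nat -> R).

(** As 2 t_m = t_(m-1), consecutive drops concern adjacent intervals, enumerated backwards in
    time. *)
Definition big_drop i : set Omega :=
  [set w | inc (dyad (N + i)) (2 * dyad (N + i)) w < - y i].

Lemma measurable_big_drop i : measurable (big_drop i).
Proof. exact: measurable_inc_lt. Qed.

Lemma Pr_big_drop i : Pr P (big_drop i) = neg_tail (y i / dyad (N + i) `^ alpha^-1).
Proof.
have h := @dyad_gt0 R (N + i); rewrite neg_tail_inc ?ltW//; last by lra.
by congr (neg_tail (_ / _ `^ _)); ring.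
Qed.

(* At level [n] the grid consists of the dyadic points of [0, t_n], at which
   [exc_dyadic] is evaluated, followed by t_n < t_{n-1} < ... < t_0. *)
Lemma first_drop_indep n m u :
  Pr P (~` exc_dyadic (dyad (N + n)) u m `&` first big_drop n) =
    Pr P (~` exc_dyadic (dyad (N + n)) u m) * Pr P (first big_drop n) /\
  Pr P (first big_drop n) = Pr P (big_drop n) * Pr P (~` upto big_drop n).
Proof.
set s := dyad (N + n); have s0 : 0 < s by exact: dyad_gt0.
set K := (2 ^ m)%N.
pose g (i : nat) := if (i <= K)%N then s * (i%:R / 2 ^+ m) else s * 2 ^+ (i - K).
have gl i : (i <= K)%N -> g i = s * (i%:R / 2 ^+ m) by rewrite /g => ->.
have gK l : g (K + l)%N = s * 2 ^+ l.
  case: l => [|l]; last by rewrite /g addnC leqNgt ltnS leq_addl addnK.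
  by rewrite addn0 gl// /K natrX divff ?expf_neq0.
have g0 : g 0%N = 0 by rewrite gl// mul0r mulr0.
have gS i : g i <= g i.+1.
  have [iK|Ki] := ltnP i K.
    by rewrite !gl ?(ltnW iK)// ler_pM2l// ler_wpM2r ?invr_ge0 ?exprn_ge0// ler_nat.
  by rewrite -(subnKC Ki) -addnS !gK ler_pM2l// exprS ler_peMl ?exprn_ge0// ler1n.
have dyadE l : (l <= n)%N -> dyad (N + (n - l)) = s * 2 ^+ l.
  move=> ln; rewrite /s /dyad -{2}(subnK ln) addnA [in RHS]exprD invfM -mulrA.
  by rewrite mulVf ?mulr1// expf_neq0.
have YE l : (l <= n)%N ->
    gridinc g (K + l) = inc (dyad (N + (n - l))) (2 * dyad (N + (n - l))).
  by move=> ln; rewrite /gridinc -addnS !gK dyadE// exprS mulrCA.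
(* Grid order is time order, opposite to the order of the drops: index K carries drop n, index K + l
   the absence of drop n - l. *)
pose D (i : nat) := if i == K then [set z : R | z < - y n]
  else ~` [set z : R | z < - y (n - (i - K))%N].
have mD i : measurable (D i).
  by rewrite /D; case: ifP => _; [|apply: measurableC]; exact: measurable_lt.
have DE l w : (0 < l <= n)%N -> D (K + l)%N (gridinc g (K + l) w) <-> ~ big_drop (n - l) w.
  move=> /andP[l0 ln]; rewrite /D addKn -{2}[K]addn0 eqn_add2l gtn_eqF// YE//.
have D0 w : D K (gridinc g K w) <-> big_drop n w.
  by rewrite /D eqxx -{1}[K]addn0 YE// subn0.
have nupto : ~` upto big_drop n = cyl (gridinc g) K.+1 (K + n.+1) D.
  apply/seteqP; split => w /=.
    move=> h i /andP[Ki iK]; rewrite -(subnKC (ltnW Ki)).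
    apply/DE; first by apply/andP; split; lia.
    by move=> b; apply: h; exists (n - (i - K))%N => //; lia.
  move=> h [j jn bj]; have := h (K + (n - j))%N.
  rewrite DE; last by apply/andP; split; lia.
  by rewrite subKn ?(ltnW jn)// => /(_ _); apply => //; apply/andP; split; lia.
have firstE : first big_drop n = cyl (gridinc g) K (K + n.+1) D.
  rewrite /first nupto; apply/seteqP; split => w /=.
    move=> [b h] i /andP[]; rewrite leq_eqVlt => /predU1P[<- _|Ki iK]; first exact/D0.
    by apply: h; rewrite Ki.
  move=> h; split; first by apply/D0; apply: h; apply/andP; split; lia.
  by move=> i /andP[Ki iK]; apply: h; rewrite (ltnW Ki).
have mY i : measurable_fun setT (gridinc g i) by exact: measurable_inc.
have gp : 0 <= g 0%N by rewrite g0.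
have indg k B : (forall i, measurable (B i)) -> Pr P (cyl (gridinc g) 0 k B) =
  \prod_(0 <= i < k) Pr P (gridinc g i @^-1` B i) by exact: gridinc_indep.
split.
  rewrite firstE; apply: indep_past => //.
  apply: (@measurableC _ (g_sigma_algebraType (past (gridinc g) K))).
  have -> : exc_dyadic s u m = upto (fun k => if (k <= K)%N then
      [set w | 3 * u < `|inc (g 0%N) (g k) w|] else set0) K.+1.
    apply/seteqP; split => w [k kK h]; exists k => //; move: h; rewrite -ltnS kK.
      by rewrite g0 gl.
    by rewrite g0 gl.
  apply: (@measurable_upto _ (g_sigma_algebraType (past (gridinc g) K))) => k.
  case: ifP => // kK.
  exact: (@past_inc g K k _ kK (measurable_gt_norm (3 * u))).
rewrite firstE nupto !Pr_cyl// big_ltn ?addnS ?ltnS ?leq_addr//; congr (_ * _).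
by congr (Pr P _); apply/seteqP; split => w /D0.
Qed.

(** Independence of the drops enters through the second part of [first_drop_indep]: the probability
    of no drop decreases at step n by that of a first drop at n. *)
Lemma Pr_upto_drop n :
  Pr P (~` upto big_drop n) = \prod_(0 <= i < n) (1 - Pr P (big_drop i)).
Proof.
elim: n => [|n IH]; first by rewrite big_geq// upto0 setC0 PrT.
have mu k : measurable (upto big_drop k).
  by apply: measurable_upto => i; exact: measurable_big_drop.
have mf k : measurable (first big_drop k).
  by apply: measurable_first => i _; exact: measurable_big_drop.
rewrite big_nat_recr//= -IH.
have [_ h] := first_drop_indep n 0 0.
have : Pr P (upto big_drop n.+1) = Pr P (upto big_drop n) + Pr P (first big_drop n).
  rewrite -[upto _ n.+1]upto_first uptoS upto_first PrU//.
  by apply/seteqP; split => w //= [? [_]]; exact.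
by rewrite h !PrC// => ->; ring.
Qed.

(** The events [first big_drop n] are disjoint, each independent of the calm on [0, t_(N+n)], so
    calm costs only the factor a; the other factor bounds the probability of some drop among the
    first M. *)
Lemma hits_lower_bound (a L : R) M : 0 <= a -> 0 <= L ->
  (forall n, 0 <= x n) ->
  (forall n, a <= Pr P (~` exc (dyad (N + n)) (x n))) ->
  L <= \sum_(0 <= i < M) Pr P (big_drop i) ->
  a * (1 - (1 + L)^-1) <=
    Pr P (\bigcup_n (big_drop n `&` ~` exc (dyad (N + n)) (x n))).
Proof.
move=> a0 L0 x0 ha hL.
pose U n := ~` exc (dyad (N + n)) (x n) `&` first big_drop n.
have mf k : measurable (first big_drop k).
  by apply: measurable_first => i _; exact: measurable_big_drop.
have me n : measurable (~` exc (dyad (N + n)) (x n)).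
  by apply: measurableC; exact: measurable_exc.
have mU n : measurable (U n) by exact: measurableI.
have mup : measurable (upto big_drop M).
  by apply: measurable_upto => k; exact: measurable_big_drop.
have hU n : a * Pr P (first big_drop n) <= Pr P (U n).
  (* Independence is available at each dyadic level m; the calm event is the decreasing intersection
     of these levels. *)
  have UE : U n = \bigcap_m (~` exc_dyadic (dyad (N + n)) (x n) m `&` first big_drop n).
    apply/seteqP; split => w /=.
      by move=> [ne f] m _; split => // e; apply: ne; exists m.
    move=> h; split; last by have [] := h 0%N I.
    by move=> [m _ e]; have [] := h m I.
  rewrite UE; apply: Pr_bigcap_ge.
  - by move=> m; apply: measurableI => //; apply: measurableC; exact: measurable_exc_dyadic.
  - by move=> m1 m2 m12; apply: setSI; apply: subsetC; exact: exc_dyadic_homo.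
  - move=> m; rewrite (first_drop_indep n m (x n)).1.
    apply: ler_wpM2r; first exact: Pr_ge0.
    apply: (le_trans (ha n)); apply: le_Pr => //.
      by apply: measurableC; exact: measurable_exc_dyadic.
    by apply: subsetC => w h; exists m.
apply: (@le_trans _ _ (Pr P (upto U M))); last first.
  apply: le_Pr; first exact: measurable_upto.
    by apply: bigcupT_measurable => n; apply: measurableI => //; exact: measurable_big_drop.
  by move=> w [k _ [nE [bk _]]]; exists k.
rewrite Pr_upto//; last by move=> i j w ij [_ h1] [_]; exact: first_disjoint h1.
apply: (@le_trans _ _ (\sum_(n < M) a * Pr P (first big_drop n))); last first.
  by apply: ler_sum => n _; exact: hU.
rewrite -mulr_sumr ler_wpM2l//.
rewrite -Pr_upto//; last by move=> i j w; exact: first_disjoint.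
rewrite upto_first -[upto _ _]setCK PrC; last exact: measurableC.
rewrite lerD2l lerN2 Pr_upto_drop.
have p01 i : 0 <= Pr P (big_drop i) <= 1.
  by rewrite Pr_ge0 Pr_le1//; exact: measurable_big_drop.
rewrite -[_^-1]mul1r ler_pdivlMr; last by lra.
apply: le_trans (prod_compl_le M p01); apply: ler_wpM2l; last by lra.
by apply: prodr_ge0 => i _; have := p01 i; lra.
Qed.

End Hits.

(** Divergence lets L grow in [hits_lower_bound], so [ev k N] is at least as likely as the lower
    bound for calm at level k. This bound tends to 1 with k, so for all K and N the union over k >=
    K has probability 1. The witness K' depends on the path. *)
Lemma drops_io (G : nat -> R) (c0 : R) (N0 : nat) : 0 < c0 ->
  (forall n, 0 <= G n) ->
  (forall n, (N0 <= n)%N -> c0 * dyad n `^ alpha^-1 <= G n) ->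
  (forall K : R, 0 < K -> forall N L, exists M, L <=
     \sum_(0 <= i < M) neg_tail (5 * (K * G (N + i)%N) / dyad (N + i) `^ alpha^-1)) ->
  {ae P, forall w, forall K N : nat, exists n, (N <= n)%N /\ exists K' : R,
     [/\ K%:R < K', ~ exc (dyad n) (K' * G n / 3) w &
         inc (dyad n) (2 * dyad n) w < - (5 * (K' * G n))]}.
Proof.
move=> c00 G0 hG hdiv.
pose y (k N i : nat) : R := 5 * (k.+1%:R * G (N + i)%N).
(* The division by 3 cancels the 3 inside [exc]. *)
pose x (k N i : nat) : R := k.+1%:R * G (N + i)%N / 3.
pose ev k N := \bigcup_i (big_drop N (y k N) i `&` ~` exc (dyad (N + i)) (x k N i)).
have mev k N : measurable (ev k N).
  apply: bigcupT_measurable => i; apply: measurableI; first exact: measurable_big_drop.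
  by apply: measurableC; exact: measurable_exc.
have x0 k N i : 0 <= x k N i by rewrite divr_ge0// mulr_ge0.
have evP k N : (N0 <= N)%N -> 1 - 2 * abs_tail (c0 * k.+1%:R / 3) <= Pr P (ev k N).
  move=> N0N; set a := 1 - _.
  have [a0|a0] := leP a 0; first exact: le_trans a0 (Pr_ge0 _ _).
  rewrite leNgt; apply/negP => lt.
  have gap : 0 < a - Pr P (ev k N) by rewrite subr_gt0.
  (* Chosen so that a / (1 + L) < a / L, which is the supposed gap. *)
  pose L := a / (a - Pr P (ev k N)); have L0 : 0 < L by rewrite /L divr_gt0.
  have [M hM] := hdiv k.+1%:R (ltr0Sn _ _) N L.
  have ha n : a <= Pr P (~` exc (dyad (N + n)) (x k N n)).
    rewrite PrC; last exact: measurable_exc.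
    rewrite lerD2l lerN2; apply: (le_trans (Pr_exc (dyad_gt0 _) (x0 _ _ _))).
    rewrite ler_pM2l//; apply: abs_tail_nonincr; rewrite ler_pdivlMr ?powR_gt0 ?dyad_gt0//.
    have := hG (N + n)%N (leq_trans N0N (leq_addr _ _)); rewrite /x => h.
    have : k.+1%:R * (c0 * dyad (N + n) `^ alpha^-1) <= k.+1%:R * G (N + n)%N.
      by rewrite ler_pM2l// ltr0Sn.
    lra.
  have := hits_lower_bound (ltW a0) (ltW L0) (x0 k N) ha.
  move=> /(_ (y k N) M); rewrite (eq_bigr _ (fun i _ => Pr_big_drop N (y k N) i)).
  move=> /(_ hM); rewrite -/(ev k N) leNgt => /negP; apply.
  rewrite mulrBr mulr1; have : a * (1 + L)^-1 < a - Pr P (ev k N).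
    by rewrite ltr_pdivrMr ?ltr_wpDr ?ltW// mulrDr mulr1 /L mulrC divfK ?gt_eqF// ltrDr.
  by lra.
have ev1 K N : (N0 <= N)%N -> Pr P (~` \bigcup_k ev (K + k)%N N) = 0.
  move=> N0N; have mU : measurable (\bigcup_k ev (K + k)%N N) by exact: bigcupT_measurable.
  rewrite PrC//; apply/eqP; rewrite subr_eq0 eq_sym eq_le Pr_le1//=.
  rewrite leNgt; apply/negP => lt.
  have [l l0 ql] := @abs_tail_cvg0 ((1 - Pr P (\bigcup_k ev (K + k)%N N)) / 3) ltac:(lra).
  have [k /andP[_ hk]] := grid_above (ltW l0) (divr_gt0 c00 (ltr0Sn R 2)).
  have : 1 - 2 * abs_tail l <= Pr P (\bigcup_k ev (K + k)%N N).
    apply: (@le_trans _ _ (Pr P (ev (K + k)%N N))); last first.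
      by apply: le_Pr => // w; exists k.
    apply: le_trans (evP _ _ N0N); rewrite lerD2l lerN2 ler_pM2l//.
    apply: abs_tail_nonincr; apply: (le_trans (ltW hk)).
    by rewrite mulrCA -mulrA ler_pM2l// ler_pM2r ?invr_gt0// ler_nat ltnS leq_addl.
  lra.
have hbad : {ae P, forall w, forall K N, (\bigcup_k ev (K + k)%N (N0 + N)%N) w}.
  have : P.-negligible (\bigcup_K \bigcup_N ~` \bigcup_k ev (K + k)%N (N0 + N)%N).
    apply: negligible_bigcup => K; apply: negligible_bigcup => N.
    apply/Pr_neg; last by rewrite ev1// leq_addr.
    by apply: measurableC; exact: bigcupT_measurable.
  apply: negligibleS => w /= /existsNP[K /existsNP[N h]].
  by exists K => //; exists N.
apply: filterS hbad => w hw K N.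
have [k _ [i _ [hi1 hi2]]] := hw K N.
exists (N0 + N + i)%N; split; first by lia.
exists (K + k).+1%:R; split => //.
by rewrite ltr_nat ltnS leq_addr.
Qed.

(** By scaling and the tail bound, the exceedance of e G(n) has probability at most a constant times
    e^(-alpha) t_n G(n)^(-alpha), which is summable: first Borel-Cantelli lemma. Taking e = 1 / (j +
    1) leaves a countable union of null sets. *)
Lemma sup_small_ae (G : nat -> R) (S : R) : (forall n, 0 < G n) ->
  (forall M, \sum_(0 <= i < M) dyad i * G i `^ (- alpha) <= S) ->
  {ae P, forall w, forall j : nat, exists N, forall n, (N <= n)%N ->
     ~ exc (dyad n) (j.+1%:R^-1 * G n) w}.
Proof.
move=> G0 hS; have [K K0 hq] := abs_tail_le.
have sj j : \forall w \ae P, exists N, forall n, (N <= n)%N ->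
     ~ exc (dyad n) (j.+1%:R^-1 * G n) w.
  set e : R := j.+1%:R^-1; have e0 : 0 < e by rewrite invr_gt0.
  pose F n := exc (dyad n) (e * G n).
  have mF n : measurable (F n) by exact: measurable_exc.
  have hF n : Pr P (F n) <= (2 * K * e `^ (- alpha)) * (dyad n * G n `^ (- alpha)).
    have p0 : 0 < dyad n `^ alpha^-1 by rewrite powR_gt0// dyad_gt0.
    apply: (le_trans (Pr_exc (dyad_gt0 _) _)); first by rewrite mulr_ge0// ltW.
    set z := e * G n / _; have z0 : 0 < z by rewrite /z divr_gt0// mulr_gt0.
    have zE : z `^ (- alpha) = e `^ (- alpha) * (dyad n * G n `^ (- alpha)).
      have i0 : 0 <= (dyad n `^ alpha^-1)^-1 by rewrite invr_ge0 ltW.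
      rewrite /z (powRM _ (ltW (mulr_gt0 e0 (G0 n))) i0) (powRM _ (ltW e0) (ltW (G0 n))).
      rewrite -mulrA; congr (_ * _); rewrite mulrC; congr (_ * _).
      rewrite -powRN -powRrM mulrNN mulVf ?gt_eqF// powRr1// ltW// dyad_gt0//.
    by have := hq z z0; rewrite zE; lra.
  have : P (lim_sup_set F) = 0%E.
    apply: lim_sup_set_cvg0 => //.
    apply: (@le_lt_trans _ _ (2 * K * e `^ (- alpha) * S)%:E); last exact: ltry.
    apply: lime_le; first by apply: is_cvg_nneseries.
    apply: nearW => M.
    apply: (@le_trans _ _ (\sum_(0 <= i < M) (Pr P (F i))%:E)%E).
      by apply: lee_sum => i _; rewrite -PrE.
    rewrite sumEFin lee_fin.
    apply: (@le_trans _ _ (\sum_(0 <= i < M) (2 * K * e `^ (- alpha)) * (dyad i * G i `^ (- alpha)))).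
      by apply: ler_sum => i _; exact: hF.
    rewrite -mulr_sumr ler_pM2l//.
    by rewrite !mulr_gt0// powR_gt0.
  move=> /negligibleP; rewrite /almost_everywhere => h.
  apply: negligibleS (h _); last first.
    by apply: bigcapT_measurable => n; apply: bigcup_measurable => k _.
  move=> w /= /forallNP hw n _; have /existsNP[k /not_implyP[nk /contrapT h1]] := hw n.
  by exists k.
rewrite /almost_everywhere/=; have : P.-negligible (\bigcup_j ~` [set w | exists N, forall n, (N <= n)%N ->
     ~ exc (dyad n) (j.+1%:R^-1 * G n) w]) by apply: negligible_bigcup => j; exact: sj.
by apply: negligibleS => w /= /existsNP[j h]; exists j.
Qed.

End StableProcess.

(** * Criteria for the upper limit at 0 *)

Section LimsupAtZero.
Context {R : realType}.
Implicit Types g : R -> R.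

Lemma nbhs_at_right0 (d : R) : 0 < d -> (0^'+ : set_system R) [set t | 0 < t < d].
Proof.
move=> d0; near=> t; apply/andP; split; near: t.
  exact: nbhs_right_gt.
exact: nbhs_right_lt.
Unshelve. all: by end_near. Qed.

Lemma limsup0_pinfty g :
  (forall B d : R, 0 < d -> exists t, 0 < t < d /\ B <= g t) ->
  limsup0 g = +oo%E.
Proof.
move=> h; rewrite /limsup0 limf_esupE; apply/ereal_inf_pinfty => _ [V V0 <-].
have [d d0 hV] := at_rightP V0.
apply/eqyP => B B0; have [t [td Bt]] := h B d d0.
apply: (@le_trans _ _ (g t)%:E); first by rewrite lee_fin.
by apply: ereal_sup_ubound; exists t => //; apply: hV; rewrite add0r.
Qed.

Lemma limsup0_eq0 g :
  (forall e : R, 0 < e -> exists2 d, 0 < d & forall t, 0 < t < d -> 0 <= g t <= e) ->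
  limsup0 g = 0%E.
Proof.
move=> h; rewrite /limsup0 limf_esupE; apply/eqP; rewrite eq_le; apply/andP; split.
  apply/lee_addgt0Pr => e e0; rewrite add0e; have [d d0 hd] := h e e0.
  apply: (@le_trans _ _ (ereal_sup ((EFin \o g) @` [set t | 0 < t < d]))).
    apply: ereal_inf_lbound; exists [set t | 0 < t < d] => //.
    exact: nbhs_at_right0.
  by apply: ge_ereal_sup => _ [t td <-] /=; rewrite lee_fin; have /andP[] := hd t td.
apply: le_ereal_inf_tmp => _ [V V0 <-].
have [d d0 hV] := at_rightP V0; have [d' d'0 hd] := h 1 ltr01.
pose t := Num.min d d' / 2.
have m0 : 0 < Num.min d d' by rewrite lt_min d0.
have t0 : 0 < t by rewrite /t divr_gt0.
have tm : t < Num.min d d' by rewrite /t; lra.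
rewrite lt_min in tm; move/andP: tm => [td td'].
apply: (@le_trans _ _ (g t)%:E).
  by rewrite lee_fin; have /andP[] := hd t (introT andP (conj t0 td')).
by apply: ereal_sup_ubound; exists t => //; apply: hV; rewrite add0r t0.
Qed.

End LimsupAtZero.

(** * From path bounds to the upper limit of |C'| f *)

Section RateFunction.
Context {R : realType}.
Variable f : R -> R.
Hypothesis f_cont : {within `[0, +oo[%classic, continuous f}.
Hypothesis f_incr : {in `[0, +oo[ &, {homo f : s t / s < t}}.
Hypothesis f_conc : concave_function `[0, +oo[%classic f.
Hypothesis f0 : f 0 = 0.

Definition quot (t : R) := t / f t.

Local Notation F := quot.

Lemma rate_gt0 t : 0 < t -> 0 < f t.
Proof.
by move=> t0; rewrite -f0; apply: f_incr => //; rewrite in_itv/= ?lexx// ltW.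
Qed.

Lemma rate_le s t : 0 <= s -> s <= t -> f s <= f t.
Proof.
move=> s0; rewrite le_eqVlt => /predU1P[->//|st]; apply/ltW/f_incr => //.
  by rewrite in_itv/= s0.
by rewrite in_itv/= (le_trans s0 (ltW st)).
Qed.

(** Concavity at 0, s, t with f(0) = 0. It yields both the monotonicity of F and f(t / 2) >= f(t) /
    2. *)
Lemma rate_scale s t : 0 <= s -> s <= t -> f t * s <= f s * t.
Proof.
move=> s0 st; have := @convex_three_point _ _ _ f_conc 0 s t.
rewrite /= !in_itv/= !andbT lexx s0 (le_trans s0 st) st f0 => /(_ isT isT isT).
lra.
Qed.

Lemma rate_near0 (e : R) : 0 < e -> exists2 d, 0 < d & forall t, 0 < t < d -> f t <= e.
Proof.
move=> e0; have [_ h] := (continuous_within_itvcyP 0 f).1 f_cont.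
move/cvgrPdist_le/(_ _ e0)/at_rightP: h => [d d0 hd]; exists d => // t td.
have := hd t; rewrite add0r f0 sub0r normrN => /(_ td).
by rewrite gtr0_norm// rate_gt0//; case/andP: td.
Qed.

Lemma quot_gt0 t : 0 < t -> 0 < F t.
Proof. by move=> t0; rewrite /quot divr_gt0// rate_gt0. Qed.

Lemma quot_le s t : 0 < s -> s <= t -> F s <= F t.
Proof.
move=> s0 st; have t0 := lt_le_trans s0 st.
rewrite /quot ler_pdivrMr ?rate_gt0// mulrAC ler_pdivlMr ?rate_gt0//.
by have := rate_scale (ltW s0) st; lra.
Qed.

Lemma quot_scale s t : 0 < s -> s <= t -> F t * s <= F s * t.
Proof.
move=> s0 st; have t0 := lt_le_trans s0 st.
have -> : F t * s = t * s * (f t)^-1 by rewrite /quot mulrAC.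
have -> : F s * t = t * s * (f s)^-1 by rewrite /quot mulrAC [s * t]mulrC.
rewrite ler_pM2l ?mulr_gt0// lef_pV2 ?posrE ?rate_gt0//.
by rewrite rate_le// ltW.
Qed.

Variables (T : R) (x C : R -> R).
Hypothesis T0 : 0 < T.
Hypothesis hC : is_convex_minorant T x C.
Hypothesis x0 : x 0 = 0.

Let rd := right_derivative C.

(** With e' = e / 4, the line from - e' F(t) at 0 with slope - e' F(t) / t lies below x on [0, t]
    because F increases, and on [t, d] because F(s) / s decreases. Beyond d it lies below - B, hence
    below C: it has fallen by e' d / f(t), and f(t) is small. At t it gives C_t >= - 2 e' F(t), and
    the chord from 0 bounds C' below. *)
Lemma limsup_flat :
  (forall e : R, 0 < e -> exists2 d, 0 < d & forall s, 0 < s <= d -> - (e * F s) <= x s) ->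
  limsup0 (fun t => `|rd t| * f t) = 0%E.
Proof.
move=> hx; apply: limsup0_eq0 => e e0.
have [B B0 hB] := minorant_bounded T0 hC.
have e4 : 0 < e / 4 by lra.
have [d0 d00 hd0] := hx _ e4.
have [d [dd0 dT hd]] : exists d, [/\ 0 < d, d <= T &
    forall s, 0 < s <= d -> - (e / 4 * F s) <= x s].
  exists (Num.min d0 T); split; first by rewrite lt_min d00 T0.
    by rewrite ge_min lexx orbT.
  by move=> s /andP[s0 sd]; apply: hd0; rewrite s0 (le_trans sd)// ge_min lexx.
(* A bound for the slope of the chord from t to T when t <= T / 2, hence for C'; multiplied by f(t)
   it tends to 0. *)
pose U := 2 * (`|C T| + B) / T.
have U0 : 0 < U by rewrite /U divr_gt0// mulr_gt0// ltr_wpDl.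
have [d1 d10 hd1] := rate_near0 (divr_gt0 (mulr_gt0 e4 dd0) B0).
have [d2 d20 hd2] := rate_near0 (divr_gt0 e0 U0).
exists (Num.min (Num.min d1 d2) (Num.min d (T / 2))).
  by rewrite !lt_min d10 d20 dd0 divr_gt0.
move=> t /andP[t0]; rewrite !lt_min => /andP[/andP[td1 td2] /andP[td tT]].
have ft := rate_gt0 t0.
rewrite mulr_ge0 ?(ltW ft)//=.
have tT' : t < T by lra.
have C0 : C 0 <= 0 by rewrite -[leRHS]x0; apply: (minorant_le hC); rewrite lexx ltW.
suff /andP[h1 h2] : - e <= rd t * f t <= e.
  by rewrite -{1}(gtr0_norm ft) -normrM ler_norml h1.
apply/andP; split; last first.
  have := @rd_le _ T x C hC t (T - t) t0; rewrite subr_gt0 subrKC => /(_ tT' (lexx _)) h.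
  have : rd t <= U.
    apply: (le_trans h); rewrite ler_pdivrMr ?subr_gt0//.
    have h1 := ler_norm (C T); have h2 := hB t (introT andP (conj (ltW t0) (ltW tT'))).
    have : U * (T / 2) <= U * (T - t) by rewrite ler_pM2l//; lra.
    have -> : U * (T / 2) = `|C T| + B by rewrite /U; field; rewrite gt_eqF.
    lra.
  rewrite -(ler_pM2r ft) => /le_trans; apply.
  by rewrite mulrC -ler_pdivlMr//; apply: hd2; rewrite t0.
have Ct : - (e / 4 * F t) / t * t + - (e / 4 * F t) <= C t.
  apply: (affine_le_minorant hC); last by rewrite !ltW.
  move=> s /andP[s0 sT].
  have [->|sn0] := eqVneq s 0.
    by left; rewrite x0 mulr0 add0r oppr_le0 mulr_ge0// ltW// quot_gt0.
  have {sn0} s0' : 0 < s by rewrite lt_neqAle eq_sym sn0.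
  have P0 : 0 < e / 4 * F t by rewrite mulr_gt0// quot_gt0.
  have Q0 : 0 < e / 4 * F t / t by rewrite divr_gt0.
  have [st|ts] := leP s t.
    left; apply: (@le_trans _ _ (- (e / 4 * F s))); last first.
      by apply: hd; rewrite s0' (le_trans st)// ltW.
    have : e / 4 * F s <= e / 4 * F t by rewrite ler_pM2l// quot_le.
    by have := mulr_gt0 Q0 s0'; lra.
  have [sd|ds] := leP s d.
    left; apply: (@le_trans _ _ (- (e / 4 * F s))); last by apply: hd; rewrite s0'.
    have : e / 4 * F s <= e / 4 * F t / t * s.
      have -> : e / 4 * F t / t * s = e / 4 * (F t * s / t) by ring.
      rewrite ler_pM2l// ler_pdivlMr//.
      by apply: quot_scale => //; exact: ltW.
    lra.
  right; apply: (@le_trans _ _ (- B)); last by apply: hB; rewrite s0.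
  have : B <= e / 4 * F t / t * d.
    have -> : e / 4 * F t / t * d = e / 4 * d / f t.
      by rewrite /quot; field; rewrite !gt_eqF.
    have := hd1 t (introT andP (conj t0 td1)).
    by rewrite !ler_pdivlMr// mulrC.
  have : e / 4 * F t / t * d <= e / 4 * F t / t * s by rewrite ler_pM2l// ltW.
  lra.
have := @rd_ge _ T x C hC 0 t (lexx _) t0 tT'; rewrite subr0 => /(le_trans _) h.
have : - (e / 2) / f t <= rd t.
  apply: h; rewrite ler_pdivlMr//.
  move: Ct; rewrite divfK ?gt_eqF// => Ct.
  have -> : - (e / 2) / f t * t = - (e / 4 * F t) + - (e / 4 * F t).
    by rewrite /quot; field; rewrite gt_eqF.
  lra.
by rewrite ler_pdivrMr//; lra.
Qed.

(** At t_n / 2 the derivative is at most - K' G(n) / t_n and f(t_n / 2) >= f(t_n) / 2, so |C'| f is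
    at least K' G(n) / (2 F(t_n)) >= K' c1 / 2, where K' is as large as desired. *)
Lemma limsup_steep (tn G : nat -> R) (c1 : R) (N1 : nat) : 0 < c1 ->
  (forall n, 0 < tn n) -> (forall e, 0 < e -> exists N, forall n, (N <= n)%N -> tn n < e) ->
  (forall n, (N1 <= n)%N -> c1 * F (tn n) <= G n) ->
  (forall K N : nat, exists n, (N <= n)%N /\ exists K' : R,
     [/\ K%:R < K', forall s, 0 <= s <= tn n -> - (K' * G n) <= x s &
         x (2 * tn n) <= - (4 * (K' * G n))]) ->
  limsup0 (fun t => `|rd t| * f t) = +oo%E.
Proof.
move=> c10 tn0 tnc hG h; apply: limsup0_pinfty => B d d0.
have md : 0 < Num.min d (T / 2) by rewrite lt_min d0 divr_gt0.
have [N hN] := tnc _ md.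
have [K /andP[_ hK]] := grid_above (normr_ge0 (2 * B)) c10.
have [n [nN [K' [KK' h1 h2]]]] := h K.+1 (maxn N N1).
have t0 := tn0 n; set t := tn n in t0 h1 h2 *.
have := hN n (leq_trans (leq_maxl _ _) nN); rewrite -/t lt_min => /andP[td tT].
have cG := hG n (leq_trans (leq_maxr _ _) nN).
have Ft := quot_gt0 t0; have G0 : 0 < G n by apply: lt_le_trans cG; rewrite mulr_gt0.
have K'0 : 0 < K' by apply: lt_trans KK'; rewrite ltr0Sn.
have A0 : 0 < K' * G n by rewrite mulr_gt0.
have := @steep_slope _ T x C hC (K' * G n) t A0 t0 _ h1 h2.
move=> /(_ ltac:(lra)) hr.
exists (t / 2); split; first by apply/andP; split; lra.
have t2 : 0 < t / 2 by lra.
have f2 := rate_gt0 t2; have ft := rate_gt0 t0.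
have : f t / 2 <= f (t / 2).
  have := @rate_scale (t / 2) t (ltW t2) ltac:(lra).
  by rewrite mulrA mulrAC ler_pM2r.
move=> ff.
have : K' * G n / t <= `|rd (t / 2)| by rewrite lerNr in hr; rewrite (le_trans hr)// -normrN ler_norm.
move=> rr.
have A1 : 0 <= K' * G n / t by rewrite ltW// divr_gt0.
have := ler_pM A1 (ltW (divr_gt0 ft (ltr0Sn R 1))) rr ff.
apply: le_trans.
have : K' * (c1 * F t) <= K' * G n by rewrite ler_pM2l.
have : `|2 * B| <= K' * c1.
  apply: (le_trans (ltW hK)); rewrite ler_pM2r// ltW//.
have := ler_norm (2 * B).
move=> b1 b2 b3; apply: (@le_trans _ _ (K' * c1 / 2)); first by lra.
have -> : K' * c1 / 2 = K' * (c1 * F t) / t * (f t / 2).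
  by rewrite /quot; field; rewrite !gt_eqF.
by rewrite ler_pM2r ?divr_gt0// ler_pM2r ?invr_gt0.
Qed.

End RateFunction.

(** * Comparison of the integral with a dyadic sum *)

Section DyadicSum.
Context {R : realType}.
Variable h : R -> R.
Hypothesis h_ge0 : forall t, 0 < t -> 0 <= h t.
Hypothesis h_noninc : forall s t, 0 < s -> s <= t -> h t <= h s.
Hypothesis mh : measurable_fun (`]0, 1]%classic : set R) h.

Let mu := @lebesgue_measure R.
Let cell (n : nat) : set R := `]dyad n.+1, dyad n]%classic.

Let cellP n t : cell n t <-> dyad n.+1 < t <= dyad n.
Proof. by rewrite /cell/= in_itv. Qed.

Let cell01 : \bigcup_n cell n = `]0, 1]%classic.
Proof.
apply/seteqP; split => t /=.
  move=> [n _ /cellP/andP[t1 t2]]; rewrite in_itv/= (lt_trans _ t1) ?dyad_gt0//=.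
  by apply: (le_trans t2); rewrite (le_trans (dyad_le (leq0n n)))// /dyad expr0 invr1.
rewrite in_itv/= => /andP[t0 t1].
have := @dyad_cell R t 0 t0; rewrite {1}/dyad expr0 invr1 => /(_ t1)[n [_ n1 n2]].
by exists n => //; apply/cellP; rewrite n1.
Qed.

Let cell_sub n : cell n `<=` `]0, 1]%classic.
Proof. by rewrite -cell01 => t ct; exists n. Qed.

Let measurable_cell n : measurable (cell n).
Proof. exact: measurable_itv. Qed.

Let cell_triv : trivIset setT cell.
Proof.
apply/trivIsetP => i j _ _; wlog ij : i j / (i < j)%N => [H ij|_].
  by have [lt|gt|e] := ltngtP i j; [exact: H|rewrite setIC; apply: H => //; rewrite eq_sym|rewrite e eqxx in ij].
apply/seteqP; split => t //= -[/cellP/andP[t1 _] /cellP/andP[_ t2]].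
by have := lt_le_trans t1 (le_trans t2 (dyad_le ij)); rewrite ltxx.
Qed.

Let measure_cell n : mu (cell n) = (dyad n.+1)%:E.
Proof.
rewrite /mu /cell lebesgue_measure_itv/= lte_fin.
have d0 := @dyad_gt0 R n.+1; rewrite -(dyadS n) ltr_pMl// ltr1n/=.
by rewrite -EFinB; congr EFin; ring.
Qed.

Let cell_gt0 n t : cell n t -> 0 < t.
Proof. by move=> /cellP/andP[+ _]; exact: lt_trans (dyad_gt0 _). Qed.

Let mhc n : measurable_fun (cell n) (EFin \o h).
Proof.
apply/measurable_EFinP; apply: measurable_funS mh => //; exact: cell_sub.
Qed.

Let integral_cells :
  (\int[mu]_(t in `]0%R, 1%R]) (h t)%:E = \sum_(0 <= n <oo) \int[mu]_(t in cell n) (h t)%:E)%E.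
Proof.
rewrite -cell01 ge0_integral_bigcup// cell01.
  by apply/measurable_EFinP.
by move=> t /=; rewrite in_itv/= lee_fin => /andP[t0 _]; exact: h_ge0.
Qed.

(** On ]t_(n+1), t_n], of length t_(n+1), h is at most its value at the left end: the integral over
    cell n is bounded by term n + 1. *)
Lemma integral_le_dyadic_sum (S : R) :
  (forall M, \sum_(0 <= i < M) dyad i * h (dyad i) <= S) ->
  (\int[mu]_(t in `]0%R, 1%R]) (h t)%:E <= S%:E)%E.
Proof.
move=> hS; rewrite integral_cells; apply: lime_le.
  apply: is_cvg_nneseries => n _ _; apply: integral_ge0 => t ct.
  by rewrite /= lee_fin h_ge0// (cell_gt0 ct).
apply: nearW => M; apply: (@le_trans _ _ (\sum_(0 <= i < M) (dyad i.+1 * h (dyad i.+1))%:E)%E).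
  apply: lee_sum => i _.
  apply: (@le_trans _ _ (\int[mu]_(t in cell i) (cst (h (dyad i.+1))%:E) t)%E).
    apply: ge0_le_integral => //.
    - exact: measurable_cell.
    - by move=> t ct; rewrite /= lee_fin h_ge0// (cell_gt0 ct).
    - exact: mhc.
    - by move=> t /cellP/andP[t1 _]; rewrite /= lee_fin h_noninc ?dyad_gt0// ltW.
  rewrite integral_cst; last exact: measurable_cell.
  by rewrite [X in (_ * X)%E](measure_cell i) -EFinM mulrC.
rewrite sumEFin lee_fin; apply: le_trans (hS M.+1).
rewrite big_nat_recl//= ler_wpDl// mulr_ge0 ?h_ge0 ?dyad_gt0//.
by rewrite ltW// dyad_gt0.
Qed.

(** On cell n, h is at least its value at the right end t_n, while the length is only t_n / 2, hence
    the factor 2. *)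
Lemma dyadic_sum_le_integral M :
  ((\sum_(0 <= i < M) dyad i * h (dyad i))%:E <=
   2%:E * \int[mu]_(t in `]0%R, 1%R]) (h t)%:E)%E.
Proof.
rewrite integral_cells -nneseriesZl; last first.
  move=> n _; apply: integral_ge0 => t ct.
  by rewrite /= lee_fin h_ge0// (cell_gt0 ct).
apply: le_trans (nneseries_lim_ge M _); last first.
  move=> n _ _; apply: mule_ge0 => //; apply: integral_ge0 => t ct.
  by rewrite /= lee_fin h_ge0// (cell_gt0 ct).
rewrite -sumEFin; apply: lee_sum => i _.
apply: (@le_trans _ _ (2%:E * \int[mu]_(t in cell i) (cst (h (dyad i))%:E) t)%E).
  rewrite integral_cst; last exact: measurable_cell.
  by rewrite [X in (_ * (_ * X))%E](measure_cell i) -!EFinM lee_fin mulrCA dyadS mulrC.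
apply: lee_wpmul2l => //; apply: ge0_le_integral => //.
- exact: measurable_cell.
- by move=> t ct; rewrite /= lee_fin h_ge0// dyad_gt0.
- exact: mhc.
- by move=> t ct; have /cellP/andP[_ t1] := ct; rewrite /= lee_fin h_noninc// (cell_gt0 ct).
Qed.

End DyadicSum.

Lemma divergent_sum_shift (R : realFieldType) (a b : nat -> R) N1 :
  (forall i, 0 <= a i) -> (forall i, 0 <= b i) ->
  (forall i, (N1 <= i)%N -> a i <= b i) ->
  (forall L, exists M, L <= \sum_(0 <= i < M) a i) ->
  forall N L, exists M, L <= \sum_(0 <= i < M) b (N + i)%N.
Proof.
(* The first N + N1 terms, lost to the shift and to the late comparison, are paid for in advance. *)
move=> a0 b0 ab ha N L; have [M hM] := ha (L + \sum_(0 <= i < N + N1) a i).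
exists (N1 + M)%N.
have h1 : \sum_(0 <= i < M) a i <= \sum_(0 <= i < N + N1 + M) a i.
  rewrite [leRHS](big_cat_nat (leq0n M) (leq_addl _ _))/= lerDl.
  by apply: sumr_ge0 => i _.
have h2 : \sum_(0 <= i < N + N1 + M) a i =
    \sum_(0 <= i < N + N1) a i + \sum_(0 <= j < M) a (N + N1 + j)%N.
  rewrite (big_cat_nat (leq0n (N + N1)) (leq_addr M _))/=; congr (_ + _).
  rewrite -{1}[(N + N1)%N]add0n big_addn addKn.
  by apply: eq_bigr => i _; rewrite addnC.
have h3 : \sum_(0 <= j < M) a (N + N1 + j)%N <= \sum_(0 <= i < N1 + M) b (N + i)%N.
  rewrite [leRHS](big_cat_nat (leq0n N1) (leq_addr M _))/=.
  apply: ler_wpDl; first by apply: sumr_ge0.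
  rewrite -[X in \sum_(X <= _ < _) b _]add0n big_addn addKn; apply: ler_sum => i _.
  by rewrite [(i + N1)%N]addnC addnA ab// addnAC leq_addl.
lra.
Qed.

(** * The two divergent cases and the convergent case *)

Section CorollaryCases.
Context {R : realType} {d : measure_display} {Omega : measurableType d}.
Variables (P : probability Omega R) (alpha : R) (X : R -> {RV P >-> R}).
Hypotheses (alpha0 : 0 < alpha) (hX : stable_process X alpha).
Variables (T : R) (C : R -> Omega -> R).
Hypothesis hT : 0 < T.
Hypothesis hC : {ae P, forall w, is_convex_minorant T (X^~ w) (C^~ w)}.
Variable f : R -> R.
Hypothesis f_cont : {within `[0, +oo[%classic, continuous f}.
Hypothesis f_incr : {in `[0, +oo[ &, {homo f : s t / s < t}}.
Hypothesis f_conc : concave_function `[0, +oo[%classic f.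
Hypothesis f0 : f 0 = 0.

Local Notation F := (quot f).
Local Notation h := (fun t : R => F t `^ (- alpha)).

Let F_gt0 t : 0 < t -> 0 < F t.
Proof. exact: quot_gt0. Qed.

Let h_ge0 t : 0 < t -> 0 <= h t.
Proof. by move=> _; exact: powR_ge0. Qed.

Let h_noninc s t : 0 < s -> s <= t -> h t <= h s.
Proof.
move=> s0 st; have t0 := lt_le_trans s0 st.
rewrite !powRN lef_pV2 ?posrE ?powR_gt0 ?F_gt0//.
apply: ge0_ler_powR; rewrite ?nnegrE; [exact: ltW|exact/ltW/F_gt0..|].
exact: quot_le.
Qed.

Let measurable_h : measurable_fun (`]0, 1]%classic : set R) h.
Proof.
(* Set to 0 off the positive axis, F is monotone on the whole line, hence measurable. *)
pose F0 t := if 0 < t then F t else 0.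
have mF0 : measurable_fun (setT : set R) F0.
  apply: nondecreasing_measurable => // s t st; rewrite /F0.
  case: ifPn => [s0|_]; first by rewrite (lt_le_trans s0 st) quot_le.
  by case: ifPn => // t0; exact/ltW/F_gt0.
apply: (@eq_measurable_fun _ _ _ _ _ (fun t => F0 t `^ (- alpha))).
  by move=> t /set_mem/=; rewrite in_itv/= /F0 => /andP[->].
apply: measurable_funTS; apply: (measurableT_comp (measurable_powR _)) => //.
Qed.

Lemma dyad_cvg0 (e : R) : 0 < e -> exists N, forall n, (N <= n)%N -> dyad n < e.
Proof.
move=> /small_dyadic[N hN]; exists N => n Nn.
by apply: le_lt_trans hN; exact: dyad_le.
Qed.

(** G has to dominate two scales: t^(1/alpha), so that calm at level K G is likely, and F, so that
    the resulting slope is large against 1 / f. *)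
Lemma limsup_infinite_ae (G : nat -> R) (c0 c1 : R) N0 : 0 < c0 -> 0 < c1 ->
  (forall n, 0 <= G n) ->
  (forall n, (N0 <= n)%N -> c0 * dyad n `^ alpha^-1 <= G n) ->
  (forall n, (N0 <= n)%N -> c1 * F (dyad n) <= G n) ->
  (forall K : R, 0 < K -> forall N L, exists M, L <=
     \sum_(0 <= i < M) neg_tail X (5 * (K * G (N + i)%N) / dyad (N + i) `^ alpha^-1)) ->
  {ae P, forall w,
    limsup0 (fun t => `|right_derivative (C^~ w) t| * f t) = +oo%E}.
Proof.
move=> c00 c10 G0 hG0 hG1 hdiv.
have [[X0 hc _ _] _] := hX; have hd := drops_io alpha0 hX c00 G0 hG0 hdiv.
apply: filterS2 (filterI X0 hc) (filterI hd hC) => w [Xw0 cw] [dw Cw].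
apply: (limsup_steep f_incr f_conc f0 hT Cw c10 (@dyad_gt0 R) dyad_cvg0 hG1).
move=> K N; have [n [Nn [K' [KK' nexc drop]]]] := dw K N.
exists n; split => //; exists K'.
have K3 : 3 * (K' * G n / 3) = K' * G n by field.
have sup s : 0 <= s <= dyad n -> `|X s w| <= K' * G n.
  by move=> sn; have := exc_path (dyad_gt0 n) cw nexc sn; rewrite Xw0 subr0 K3.
split => //.
  by move=> s /sup; rewrite ler_norml => /andP[].
have := sup (dyad n); rewrite lexx ltW ?dyad_gt0// => /(_ isT).
rewrite ler_norml => /andP[_ h1]; move: drop; rewrite /inc => h2.
lra.
Qed.

(** With G(n) = t_n^(1/alpha), scaling gives every drop the same probability P(X_1 < - 5 K),
    positive by infinite variation; the boundedness assumption makes G dominate F. *)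
Lemma limsup_infinite_of_bounded_quot : infinite_variation X ->
  bounded_near (fun t : R => t `^ (- alpha^-1) * F t) 0^'+ ->
  {ae P, forall w,
    limsup0 (fun t => `|right_derivative (C^~ w) t| * f t) = +oo%E}.
Proof.
move=> hIV [M0 [_ hM]].
pose M := `|M0| + 1; have M_gt0 : 0 < M by rewrite ltr_wpDl.
have /at_rightP[e e0 he] : \forall t \near 0^'+, `|t `^ (- alpha^-1) * F t| <= M.
  by apply: (hM M); rewrite /M; have := ler_norm M0; lra.
have [N0 hN0] := dyad_cvg0 e0.
have dp n : 0 < dyad n `^ alpha^-1 :> R by rewrite powR_gt0// dyad_gt0.
apply: (@limsup_infinite_ae (fun n => dyad n `^ alpha^-1) 1 M^-1 N0) => //.
- by rewrite invr_gt0.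
- by move=> n; rewrite ltW.
- by move=> n _; rewrite mul1r.
- move=> n Nn; have d0 := @dyad_gt0 R n.
  have := he (dyad n); rewrite add0r d0 hN0// => /(_ isT).
  rewrite ger0_norm; last by rewrite mulr_ge0 ?powR_ge0// ltW// F_gt0.
  rewrite powRN => hF; rewrite ler_pdivrMl// mulrC.
  by rewrite -ler_pdivrMl.
- move=> K K0 N L.
  have r0 := neg_tail_gt0 hX (5 * K) hIV.
  have [M' /andP[_ hM']] := grid_above (normr_ge0 L) r0.
  exists M'.+1; rewrite (eq_bigr (fun=> neg_tail X (5 * K))); last first.
    by move=> i _; congr (neg_tail X _); field; rewrite gt_eqF.
  rewrite sumr_const_nat subn0 -[leRHS]mulr_natl.
  by apply: (le_trans (ler_norm _)); exact: ltW.
Qed.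

(** Here G = F. The growth of t^(-1/alpha) F makes F dominate t^(1/alpha) and pushes the scaled drop
    levels beyond the threshold of [neg_tail_ge], so that from some index on a drop has probability
    at least a constant times t_n F(t_n)^(-alpha). Bounded partial sums of these would make the
    integral finite. *)
Lemma limsup_infinite_of_integral :
  t `^ (- alpha^-1) * F t @[t --> 0^'+] --> +oo -> ~ spectrally_positive X ->
  (\int[lebesgue_measure]_(t in `]0%R, 1%R]) (h t)%:E = +oo)%E ->
  {ae P, forall w,
    limsup0 (fun t => `|right_derivative (C^~ w) t| * f t) = +oo%E}.
Proof.
move=> hF nsp hint.
have Fd n : 0 < F (dyad n) by rewrite F_gt0// dyad_gt0.
have dp n : 0 < dyad n `^ alpha^-1 :> R by rewrite powR_gt0// dyad_gt0.
have large B : exists N, forall n, (N <= n)%N -> B * dyad n `^ alpha^-1 <= F (dyad n).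
  move/cvgryPge : hF => /(_ B)/at_rightP[e e0 he].
  have [N hN] := dyad_cvg0 e0; exists N => n Nn.
  have := he (dyad n); rewrite add0r dyad_gt0 hN// => /(_ isT).
  by rewrite powRN ler_pdivlMl// mulrC.
have [N0 hN0] := large 1.
apply: (@limsup_infinite_ae (fun n => F (dyad n)) 1 1 N0) => //.
- by move=> n; exact: ltW.
- by move=> n _; rewrite mul1r.
move=> K K0.
have [c c0 [y0 hr]] := neg_tail_ge alpha0 hX nsp.
have [N1 hN1] := large (`|y0| / (5 * K)).
have K5 : 0 < 5 * K by lra.
have c'0 : 0 < c * (5 * K) `^ (- alpha) by rewrite mulr_gt0// powR_gt0.
pose a i := c * (5 * K) `^ (- alpha) * (dyad i * h (dyad i)).
apply: (@divergent_sum_shift R a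
  (fun i => neg_tail X (5 * (K * F (dyad i)) / dyad i `^ alpha^-1)) N1).
- by move=> i; rewrite mulr_ge0 ?(ltW c'0)// mulr_ge0 ?powR_ge0// ltW// dyad_gt0.
- by move=> i; exact: neg_tail_ge0.
- move=> i Ni; set y := _ / dyad i `^ _.
  have yE : y `^ (- alpha) = (5 * K) `^ (- alpha) * (dyad i * h (dyad i)).
    have i0 : 0 <= (dyad i `^ alpha^-1)^-1 :> R by rewrite invr_ge0 ltW.
    rewrite /y mulrA (powRM _ (ltW (mulr_gt0 K5 (Fd i))) i0) (powRM _ (ltW K5) (ltW (Fd i))).
    rewrite -mulrA; congr (_ * _); rewrite mulrC; congr (_ * _).
    by rewrite -powRN -powRrM mulrNN mulVf ?gt_eqF// powRr1// ltW// dyad_gt0.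
  rewrite /a -mulrA -yE; apply: hr; rewrite ler_pdivlMr//.
  apply: (@le_trans _ _ (`|y0| * dyad i `^ alpha^-1)).
    by rewrite ler_pM2r// ler_norm.
  have := hN1 i Ni; rewrite mulrAC ler_pdivrMr// => /le_trans; apply.
  by rewrite mulrC mulrA.
move=> L; apply: contrapT => /forallNP nL.
pose S := L / (c * (5 * K) `^ (- alpha)).
have := @integral_le_dyadic_sum R h h_ge0 h_noninc measurable_h S.
rewrite hint leye_eq => H.
have /H // : forall M, \sum_(0 <= i < M) dyad i * h (dyad i) <= S.
move=> M; rewrite /S ler_pdivlMr// mulrC mulr_sumr.
by apply/ltW; rewrite ltNge; apply/negP; exact: nL.
Qed.

Lemma limsup_zero_of_integral :
  (\int[lebesgue_measure]_(t in `]0%R, 1%R]) (h t)%:E < +oo)%E ->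
  {ae P, forall w,
    limsup0 (fun t => `|right_derivative (C^~ w) t| * f t) = 0%E}.
Proof.
move=> hint.
have Fd n : 0 < F (dyad n) by rewrite F_gt0// dyad_gt0.
have hI0 : (0 <= \int[lebesgue_measure]_(t in `]0%R, 1%R]) (h t)%:E)%E.
  by apply: integral_ge0 => t _; rewrite lee_fin powR_ge0.
pose S := 2 * fine (\int[lebesgue_measure]_(t in `]0%R, 1%R]) (h t)%:E)%E.
have hS M : \sum_(0 <= i < M) dyad i * h (dyad i) <= S.
  rewrite -lee_fin /S EFinM fineK ?ge0_fin_numE//.
  exact: dyadic_sum_le_integral.
have hs := sup_small_ae alpha0 hX Fd hS.
have [[X0 hc _ _] _] := hX.
apply: filterS2 (filterI X0 hc) (filterI hs hC) => w [Xw0 cw] [sw Cw].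
apply: (limsup_flat f_cont f_incr f_conc f0 hT Cw Xw0) => e e0.
(* 6 is the 3 of [exc] times the 2 of F(t_n) <= 2 F(s), valid for s in ]t_(n+1), t_n]. *)
have /small_inv[j hj] : 0 < e / 6 by lra.
have [N hN] := sw j; exists (dyad N); first exact: dyad_gt0.
move=> s /andP[s0 sN]; have [n [Nn n1 n2]] := dyad_cell s0 sN.
have sn : 0 <= s <= dyad n by rewrite (ltW s0).
have := exc_path (dyad_gt0 n) cw (hN n Nn) sn; rewrite Xw0 subr0 ler_norml.
move=> /andP[lb _]; apply: le_trans lb; rewrite lerN2.
have dS := @dyad_gt0 R n.+1.
have FF : F (dyad n) <= 2 * F s.
  apply: (@le_trans _ _ (2 * F (dyad n.+1))); last first.
    by rewrite ler_pM2l//; apply: quot_le => //; exact: ltW.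
  have := @quot_scale _ _ f_incr f0 _ _ dS (dyad_le (leqnSn n)).
  by rewrite -[X in _ <= _ * X](dyadS n) mulrA ler_pM2r// [_ * 2]mulrC.
have Fs := F_gt0 s0.
set v := j.+1%:R^-1; have v0 : 0 < v by rewrite invr_gt0.
apply: (@le_trans _ _ (3 * (v * (2 * F s)))); first by rewrite !ler_pM2l.
have -> : 3 * (v * (2 * F s)) = 6 * v * F s by ring.
rewrite ler_pM2r//; have := hj; rewrite -/v; lra.
Qed.

End CorollaryCases.

Theorem corollary2p12 (R : realType) (d : measure_display)
  (Omega : measurableType d) (P : probability Omega R)
  (alpha : R) (halpha : 1 <= alpha < 2)
  (X : R -> {RV P >-> R}) (hX : stable_process X alpha)
  (hIV : infinite_variation X)
  (T : R) (hT : 0 < T)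
  (C : R -> Omega -> R)
  (hC : {ae P, forall w, is_convex_minorant T (X^~ w) (C^~ w)})
  (f : R -> R)
  (f_ge0 : forall t : R, 0 <= t -> 0 <= f t)
  (f_cont : {within `[0, +oo[%classic, continuous f})
  (f_incr : {in `[0, +oo[ &, {homo f : s t / s < t}})
  (f_conc : concave_function `[0, +oo[%classic f)
  (f0 : f 0 = 0)
  (f_limsup : limsup0 (fun t => f (c * t) / f t) @[c --> 0^'+] --> 0%E)
  (f_le1 : forall t : R, 0 < t <= 1 -> f t <= 1)
  (f1 : f 1 = 1) :
  let F := fun t : R => t / f t in
  (bounded_near (fun t : R => t `^ (- alpha^-1) * F t) 0^'+ ->
    {ae P, forall w,
      limsup0 (fun t => `|right_derivative (C^~ w) t| * f t) = +oo%E}) /\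
  (t `^ (- alpha^-1) * F t @[t --> 0^'+] --> +oo ->
   ~ spectrally_positive X ->
    ((\int[lebesgue_measure]_(t in `]0%R, 1%R]) (F t `^ (- alpha))%:E = +oo)%E ->
      {ae P, forall w,
        limsup0 (fun t => `|right_derivative (C^~ w) t| * f t) = +oo%E}) /\
    ((\int[lebesgue_measure]_(t in `]0%R, 1%R]) (F t `^ (- alpha))%:E < +oo)%E ->
      {ae P, forall w,
        limsup0 (fun t => `|right_derivative (C^~ w) t| * f t) = 0%E})).
Proof.
move=> F; have alpha0 : 0 < alpha by lra.
split; first exact: (limsup_infinite_of_bounded_quot alpha0 hX hT hC f_incr f_conc f0 hIV).
move=> hF nsp; split.
  exact: (limsup_infinite_of_integral alpha0 hX hT hC f_incr f_conc f0 hF nsp).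
exact: (limsup_zero_of_integral alpha0 hX hT hC f_cont f_incr f_conc f0).
Qed.
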